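(* Let $E$ and $F$ be (real or complex) Banach spaces, let $n$ be a positive integer, let $1 \leq p < +\infty$, and let $P \in \mathcal{P}(^nE;F)$ be a continuous $n$-homogeneous polynomial from $E$ into $F$. Then $P$ is $p$-dominated if and only if there are a regular Borel probability measure $\mu$ on $B_{E^*}$ endowed with the weak* topology, a closed subspace $G_{E,p}$ of $L_p(\mu)$ containing $j_p(e(E))$, and a continuous linear operator $v \colon \otimes^{n,s}_{\pi_s} G_{E,p} \longrightarrow F$ such that $$P = v \circ \delta_n^{G_{E,p}} \circ j_p^e \circ e ,$$ that is, $P(x) = v\big(j_p(e(x)) \otimes \cdots \otimes j_p(e(x))\big)$ for every $x \in E$. Moreover, when $P$ is $p$-dominated, $\mu$, $G_{E,p}$ and $v$ can be taken with $\|v\| = \|P\|_{d,p}$.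
   Context: $\mathcal{P}(^nE;F)$ is the space of all continuous $n$-homogeneous polynomials from $E$ into $F$ with the usual sup norm over the closed unit ball of $E$. $B_{E^*}$ is the closed unit ball of the dual $E^*$, a compact space in the weak* topology; $C(B_{E^*})$ is the space of continuous scalar functions on $(B_{E^*}, w^* )$ with the supremum norm. A polynomial $P \in \mathcal{P}(^nE;F)$ is $p$-dominated if there is a constant $C>0$ such that $$\left( \sum_{j=1}^m\|P(x_j)\|^{p/n}\right)^{n/p}\leq C \sup_{x^*\in B_{E^*}}\left(\sum_{j=1}^m |\langle x^*,x_j\rangle|^p\right)^{n/p}$$ for every positive integer $m$ and all $x_1,\ldots,x_m \in E$; the infimum of such constants $C$ is denoted by $\|P\|_{d,p}$. The map $e \colon E \to C(B_{E^*})$ is the evaluation map $e(x) = e_x$, $e_x(x^* ) = \langle x^*, x\rangle$. For a regular Borel probability measure $\mu$ on $(B_{E^*},w^* )$, $j_p \colon C(B_{E^*}) \to L_p(\mu)$ is the canonical map (sending a function to its $\mu$-a.e. equivalence class), and $j_p^e$ is the restriction of $j_p$ to $e(E)$ onto its range $j_p(e(E))$, which is regarded as a subset of $G_{E,p}$. For a normed space $G$ (here with the norm induced by $L_p(\mu)$), $\otimes^{n,s}_{\pi_s} G$ is the (uncompleted) $n$-fold symmetric tensor product of $G$ endowed with the projective s-tensor norm $$\pi_s(\theta) = \inf\left\{\sum_{i=1}^m |\lambda_i|\,\|x_i\|^n : \theta = \sum_{i=1}^m \lambda_i\, x_i \otimes \cdots \otimes x_i,\ m \in \mathbb{N},\ \lambda_i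 \text{ scalars},\ x_i \in G\right\},$$ and $\delta_n^G \colon G \to \otimes^{n,s}_{\pi_s} G$ is the diagonal map $\delta_n^G(x) = x \otimes \cdots \otimes x$. *)

(* Defs.v *)
From HB Require Import structures.
From mathcomp Require Import all_boot all_order all_algebra.
From mathcomp Require Import generic_quotient ring_quotient complex.
From mathcomp Require Import all_classical all_reals all_analysis.
From mathcomp Require Import measurable_realfun measurable_fun_approximation.

Set Implicit Arguments.
Unset Strict Implicit.
Unset Printing Implicit Defensive.

Import Order.TTheory GRing.Theory Num.Theory.
Import numFieldNormedType.Exports.

Local Open Scope classical_set_scope.
Local Open Scope ring_scope.

Variant scalar_kind := RealScalars | ComplexScalars.

Definition scalars (R : realType) (k : scalar_kind) : numFieldType :=
  match k with
  | RealScalars => R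
  | ComplexScalars => R[i]
  end.

Definition scalar_Re {R : realType} {k : scalar_kind} : scalars R k -> R :=
  match k return scalars R k -> R with
  | RealScalars => fun x => x
  | ComplexScalars => @complex.Re R
  end.

Definition scalar_Im {R : realType} {k : scalar_kind} : scalars R k -> R :=
  match k return scalars R k -> R with
  | RealScalars => fun=> 0
  | ComplexScalars => @complex.Im R
  end.

Definition of_real {R : realType} {k : scalar_kind} : R -> scalars R k :=
  match k return R -> scalars R k with
  | RealScalars => fun x => x
  | ComplexScalars => fun x => Complex x 0
  end.

Section scalars_theory.
Context {R : realType} {k : scalar_kind}.
Local Notation K := (scalars R k).
Implicit Types (x y : K) (a b : R).

Lemma scalar_ReD x y : scalar_Re (x + y) = scalar_Re x + scalar_Re y.
Proof. by move: x y; case: k => // -[a b] [c d]. Qed.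

Lemma scalar_ImD x y : scalar_Im (x + y) = scalar_Im x + scalar_Im y.
Proof. by move: x y; case: k => [x y|[a b] [c d]] //; rewrite addr0. Qed.

Lemma scalar_ReB x y : scalar_Re (x - y) = scalar_Re x - scalar_Re y.
Proof. by apply/eqP; rewrite eq_sym subr_eq -scalar_ReD subrK. Qed.

Lemma scalar_ImB x y : scalar_Im (x - y) = scalar_Im x - scalar_Im y.
Proof. by apply/eqP; rewrite eq_sym subr_eq -scalar_ImD subrK. Qed.

Lemma scalar_ReM x y : scalar_Re (x * y) =
  scalar_Re x * scalar_Re y - scalar_Im x * scalar_Im y.
Proof. by move: x y; case: k => [x y|[a b] [c d]] //; rewrite mul0r subr0. Qed.

Lemma scalar_ImM x y : scalar_Im (x * y) =
  scalar_Re x * scalar_Im y + scalar_Im x * scalar_Re y.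
Proof.
by move: x y; case: k => [x y|[a b] [c d]] //; rewrite mulr0 mul0r addr0.
Qed.

Lemma of_realK : cancel (@of_real R k) scalar_Re.
Proof. by case: k. Qed.

Lemma of_real_inj : injective (@of_real R k).
Proof. exact: can_inj of_realK. Qed.

Lemma of_realD a b : of_real (a + b) = of_real a + of_real b :> K.
Proof. by case: k => //=; apply/eqP; rewrite eq_complex /= addr0 !eqxx. Qed.

Lemma of_realM a b : of_real (a * b) = of_real a * of_real b :> K.
Proof.
by case: k => //=; apply/eqP; rewrite eq_complex /= !mulr0 subr0 mul0r addr0 !eqxx.
Qed.

Lemma of_real0 : of_real 0 = 0 :> K.
Proof. by case: k. Qed.

Lemma ler_of_real a b : (of_real a <= of_real b :> K) = (a <= b).
Proof. by case: k => //=; rewrite lecE /= eqxx. Qed.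

Lemma ltr_of_real a b : (of_real a < of_real b :> K) = (a < b).
Proof. by rewrite !lt_neqAle ler_of_real (inj_eq (can_inj of_realK)). Qed.

Lemma of_real_scalar_Re_norm x : of_real (scalar_Re `|x|) = `|x|.
Proof.
move: x; case: k => [x //|x].
by have -> : `|x| = Complex (Num.sqrt (complex.Re x ^+ 2 + complex.Im x ^+ 2)) 0
  :> scalars R ComplexScalars by exact: normc_def.
Qed.

Lemma scalar_Re_normE x :
  scalar_Re `|x| = Num.sqrt (scalar_Re x ^+ 2 + scalar_Im x ^+ 2).
Proof.
move: x; case: k => [x|x].
  by rewrite /= expr0n addr0 sqrtr_sqr.
by have -> : `|x| = Complex (Num.sqrt (complex.Re x ^+ 2 + complex.Im x ^+ 2)) 0
  :> scalars R ComplexScalars by exact: normc_def.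
Qed.

End scalars_theory.

(* Norms of a normed module over K take their values in K; [rnorm x] is the same
   nonnegative number in R. *)
Definition rnorm {R : realType} {k : scalar_kind}
  {V : normedModType (scalars R k)} (x : V) : R := scalar_Re `|x|.

Lemma of_real_rnorm {R : realType} {k : scalar_kind}
  {V : normedModType (scalars R k)} (x : V) : of_real (rnorm x) = `|x|.
Proof. by have := of_real_scalar_Re_norm `|x|; rewrite normr_id. Qed.

Section rnorm_theory.
Context {R : realType} {k : scalar_kind} {V : normedModType (scalars R k)}.
Implicit Types x y : V.

Lemma rnorm_ge0 x : 0 <= rnorm x.
Proof. by rewrite -(ler_of_real (k := k)) of_real_rnorm of_real0. Qed.

Lemma ler_rnormD x y : rnorm (x + y) <= rnorm x + rnorm y.
Proof.
by rewrite -(ler_of_real (k := k)) of_realD !of_real_rnorm ler_normD.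
Qed.

Lemma rnormZ (a : scalars R k) x :
  rnorm (a *: x) = rnorm (a : (scalars R k)^o) * rnorm x.
Proof.
apply: (@of_real_inj R k).
by rewrite of_realM !of_real_rnorm normrZ.
Qed.

Lemma rnormN x : rnorm (- x) = rnorm x.
Proof. by rewrite /rnorm normrN. Qed.

Lemma rnorm_eq0 x : rnorm x = 0 -> x = 0.
Proof. by move=> x0; apply/normr0_eq0; rewrite -of_real_rnorm x0 of_real0. Qed.

Lemma rnorm0 : rnorm (0 : V) = 0.
Proof. by apply: (@of_real_inj R k); rewrite of_real_rnorm normr0 of_real0. Qed.

End rnorm_theory.

Section Lp_fun.
Context {R : realType} {k : scalar_kind} {d : measure_display}.
Context {T : measurableType d} (mu : {measure set T -> \bar R}) (p : R).
Local Notation K := (scalars R k).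

(* For functions T -> K; the library's L_p spaces are real-valued only. *)
Definition Lp_enorm (f : T -> K^o) : \bar R :=
  Lnorm mu p%:E (fun t => (rnorm (f t))%:E).

Definition Lp_fun_pred : {pred T -> K^o} := fun f => `[<
  [/\ measurable_fun setT (fun t => scalar_Re (f t)),
      measurable_fun setT (fun t => scalar_Im (f t)) &
      (Lp_enorm f < +oo)%E] >].

Lemma measurable_rnorm (f : T -> K^o) :
  measurable_fun setT (fun t => scalar_Re (f t)) ->
  measurable_fun setT (fun t => scalar_Im (f t)) ->
  measurable_fun setT (fun t => rnorm (f t)).
Proof.
move=> mr mi; rewrite /rnorm.
have -> : (fun t => scalar_Re `|f t|) =
   (fun t => Num.sqrt (scalar_Re (f t) ^+ 2 + scalar_Im (f t) ^+ 2)).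
  by apply/funext => t; exact: scalar_Re_normE.
have ms := continuous_measurable_fun (@sqrt_continuous R).
apply: (measurableT_comp ms); apply: measurable_funD; exact: measurable_funX.
Qed.

Lemma Lp_enorm0 (p1 : 1 <= p) : Lp_enorm 0 = 0%E.
Proof.
rewrite /Lp_enorm [X in Lnorm _ _ X](_ : _ = cst 0%E).
  by rewrite Lnorm0// eqe gt_eqF// (lt_le_trans _ p1).
by apply/funext => t /=; rewrite rnorm0.
Qed.

Lemma Lp_enormZ (p1 : 1 <= p) (a : K) (f : T -> K^o) :
  measurable_fun setT (fun t => scalar_Re (f t)) ->
  measurable_fun setT (fun t => scalar_Im (f t)) ->
  Lp_enorm (a *: f) = ((rnorm (a : K^o))%:E * Lp_enorm f)%E.
Proof.
move=> mrf mif; have mf := measurable_rnorm mrf mif.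
have p0 : 0 < p := lt_le_trans ltr01 p1.
rewrite /Lp_enorm unlock /Lnorm /=.
under eq_integral => t _.
  rewrite /= rnormZ ger0_norm ?mulr_ge0 ?rnorm_ge0// powRM ?rnorm_ge0// EFinM.
  over.
under [in RHS]eq_integral => t _ do rewrite /= ger0_norm ?rnorm_ge0//.
rewrite ge0_integralZl_EFin ?powR_ge0//; last 2 first.
  by move=> t _; rewrite lee_fin powR_ge0.
  exact/measurable_EFinP/(@measurableT_comp _ _ _ _ _ _ (@powR R ^~ p)).
rewrite poweRM ?integral_ge0//.
- by rewrite poweR_EFin -powRrM mulfV ?gt_eqF// powRr1// rnorm_ge0.
- by rewrite lee_fin powR_ge0.
- by move=> t _; rewrite lee_fin powR_ge0.
Qed.

Lemma le_Lp_enorm (p1 : 1 <= p) (f g : T -> \bar R) :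
  (forall t, 0 <= f t <= g t)%E ->
  measurable_fun setT f -> measurable_fun setT g ->
  (Lnorm mu p%:E f <= Lnorm mu p%:E g)%E.
Proof.
move=> fg mf mg; have p0 : 0 < p := lt_le_trans ltr01 p1.
rewrite unlock /Lnorm gt0_ler_poweR ?invr_ge0 ?(ltW p0)//.
- by rewrite in_itv /= leey andbT; apply: integral_ge0 => t _; exact: poweR_ge0.
- by rewrite in_itv /= leey andbT; apply: integral_ge0 => t _; exact: poweR_ge0.
apply: ge0_le_integral => //.
- by move=> t _; exact: poweR_ge0.
- exact/(measurableT_comp (measurable_poweR p))/measurableT_comp.
- exact/(measurableT_comp (measurable_poweR p))/measurableT_comp.
move=> t _; have /andP[f0 fgt] := fg t.
have g0 := le_trans f0 fgt.
by rewrite !gee0_abs// gt0_ler_poweR ?(ltW p0)// in_itv /= leey ?f0 ?g0.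
Qed.

Lemma Lp_enormD (p1 : 1 <= p) (f g : T -> K^o) :
  Lp_fun_pred f -> Lp_fun_pred g ->
  (Lp_enorm (f + g)%R <= Lp_enorm f + Lp_enorm g)%E.
Proof.
move=> /asboolP[mrf mif nf] /asboolP[mrg mig ng].
have mf := measurable_rnorm mrf mif; have mg := measurable_rnorm mrg mig.
apply: le_trans (eminkowski mu mf mg _); last by rewrite lee_fin.
apply: le_Lp_enorm => //.
- by move=> t; rewrite !lee_fin rnorm_ge0 ler_rnormD.
- apply/measurable_EFinP/measurable_rnorm.
  + under eq_fun do rewrite scalar_ReD; exact: measurable_funD.
  + under eq_fun do rewrite scalar_ImD; exact: measurable_funD.
- exact/measurable_EFinP/measurable_funD.
Qed.

Lemma Lp_fun_submod_closed (p1 : 1 <= p) : submod_closed Lp_fun_pred.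
Proof.
have p0 : 0 < p := lt_le_trans ltr01 p1.
split.
  apply/asboolP; split.
  - by rewrite [X in measurable_fun _ X](_ : _ = cst 0)//; apply/funext => t /=; case: k.
  - by rewrite [X in measurable_fun _ X](_ : _ = cst 0)//; apply/funext => t /=; case: k.
  - by rewrite Lp_enorm0// lt_neqAle.
move=> a f g /asboolP[mrf mif nf] /asboolP[mrg mig ng]; apply/asboolP.
split.
- rewrite [X in measurable_fun _ X](_ : _ = (fun t =>
    scalar_Re a * scalar_Re (f t) - scalar_Im a * scalar_Im (f t)
      + scalar_Re (g t))); last first.
    by apply/funext => t; rewrite scalar_ReD scalar_ReM.
  apply: measurable_funD => //; apply: measurable_funB; exact: measurable_funM.
- rewrite [X in measurable_fun _ X](_ : _ = (fun t =>
    scalar_Re a * scalar_Im (f t) + scalar_Im a * scalar_Re (f t)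
      + scalar_Im (g t))); last first.
    by apply/funext => t; rewrite scalar_ImD scalar_ImM.
  apply: measurable_funD => //; apply: measurable_funD; exact: measurable_funM.
- have afLp : Lp_fun_pred (a *: f).
    apply/asboolP; split.
    + rewrite [X in measurable_fun _ X](_ : _ = (fun t =>
        scalar_Re a * scalar_Re (f t) - scalar_Im a * scalar_Im (f t))).
        by apply: measurable_funB; exact: measurable_funM.
      by apply/funext => t; rewrite scalar_ReM.
    + rewrite [X in measurable_fun _ X](_ : _ = (fun t =>
        scalar_Re a * scalar_Im (f t) + scalar_Im a * scalar_Re (f t))).
        by apply: measurable_funD; exact: measurable_funM.
      by apply/funext => t; rewrite scalar_ImM.
    + by rewrite Lp_enormZ// lte_mul_pinfty ?lee_fin// rnorm_ge0.
  have /asboolP[mra mia na] := afLp.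
  apply: le_lt_trans (Lp_enormD p1 afLp _) _; first exact/asboolP.
  exact: lte_add_pinfty.
Qed.

End Lp_fun.

Section Lp_space.
Context {R : realType} {k : scalar_kind} {d : measure_display}.
Context {T : measurableType d} (mu : {measure set T -> \bar R}).
Context {p : R} (p1 : 1 <= p).
Local Notation K := (scalars R k).

(* [p1] is a phantom argument that lets the algebraic structures, which rely on
   Minkowski's inequality, be inferred. *)
Definition Lp_pred of 1 <= p : {pred T -> K^o} := Lp_fun_pred mu p.

HB.instance Definition _ := GRing.isSubmodClosed.Build K (T -> K^o)
  (Lp_pred p1) (Lp_fun_submod_closed mu p1).

Definition Lp_fun : Type := {f : T -> K^o | f \in Lp_pred p1}.

HB.instance Definition _ := SubChoice.on Lp_fun.
HB.instance Definition _ := [SubChoice_isSubLmodule of Lp_fun by <:].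

Definition Lp_null : {pred Lp_fun} :=
  fun f => `[< {ae mu, forall t, val f t = 0} >].

Lemma Lp_null_submod_closed : submod_closed Lp_null.
Proof.
split; first by apply/asboolP/aeW.
move=> a f g /asboolP f0 /asboolP g0; apply/asboolP.
have -> : val (a *: f + g) = a *: val f + val g by exact: linearP.
by apply: filterS2 f0 g0 => t ft gt; rewrite !fctE ft gt scaler0 addr0.
Qed.

HB.instance Definition _ := GRing.isSubmodClosed.Build K Lp_fun
  Lp_null Lp_null_submod_closed.

Definition Lp_space : Type := Quotient.quot Lp_null.

HB.instance Definition _ := Choice.on Lp_space.
HB.instance Definition _ := GRing.Zmodule.on Lp_space.

Definition Lp_class (f : Lp_fun) : Lp_space := (\pi_(Quotient.quot Lp_null) f)%qT.

Definition Lp_repr (q : Lp_space) : Lp_fun := repr (q : Quotient.quot Lp_null).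

Lemma Lp_reprK : cancel Lp_repr Lp_class.
Proof. by move=> q; exact: reprK. Qed.

Lemma Lp_class_eq (f g : Lp_fun) :
  Lp_class f = Lp_class g <-> {ae mu, forall t, val f t = val g t}.
Proof.
have -> : (Lp_class f = Lp_class g) <-> (f - g \in Lp_null).
  by rewrite Quotient.idealrBE; split => [/eqP|/eqP].
have sub_val : val (f - g) = val f - val g by exact: raddfB.
split=> [/asboolP|] h; last apply/asboolP.
  by apply: filterS h => t /eqP; rewrite sub_val !fctE subr_eq0 => /eqP.
by rewrite sub_val; apply: filterS h => t; rewrite !fctE => ->; rewrite subrr.
Qed.

Lemma Lp_classD (f g : Lp_fun) : Lp_class (f + g) = Lp_class f + Lp_class g.
Proof. exact: Quotient.pi_add. Qed.

Definition Lp_scale (a : K) (q : Lp_space) : Lp_space :=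
  Lp_class (a *: Lp_repr q).

Lemma Lp_class0 : Lp_class 0 = 0.
Proof. by apply: (addrI (Lp_class 0)); rewrite -Lp_classD !addr0. Qed.

Lemma Lp_repr_class (f : Lp_fun) :
  {ae mu, forall t, val (Lp_repr (Lp_class f)) t = val f t}.
Proof. by apply/Lp_class_eq; rewrite Lp_reprK. Qed.

Lemma Lp_scale_class (a : K) (f : Lp_fun) :
  Lp_scale a (Lp_class f) = Lp_class (a *: f).
Proof.
apply/Lp_class_eq.
have valZ (g : Lp_fun) : val (a *: g) = a *: val g by exact: linearZ.
rewrite !valZ.
by apply: filterS (Lp_repr_class f) => t; rewrite !fctE => ->.
Qed.

Lemma Lp_scaleA (a b : K) (q : Lp_space) :
  Lp_scale a (Lp_scale b q) = Lp_scale (a * b) q.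
Proof. by rewrite -[q]Lp_reprK !Lp_scale_class scalerA. Qed.

Lemma Lp_scale1 : left_id 1 Lp_scale.
Proof. by move=> q; rewrite -[q]Lp_reprK Lp_scale_class scale1r. Qed.

Lemma Lp_scaleDr : right_distributive Lp_scale +%R.
Proof.
move=> a q r; rewrite -[q]Lp_reprK -[r]Lp_reprK -Lp_classD !Lp_scale_class.
by rewrite scalerDr Lp_classD.
Qed.

Lemma Lp_scaleDl (q : Lp_space) : {morph Lp_scale^~ q : a b / a + b}.
Proof.
by move=> a b; rewrite -[q]Lp_reprK !Lp_scale_class scalerDl Lp_classD.
Qed.

HB.instance Definition _ := GRing.Zmodule_isLmodule.Build K Lp_space
  Lp_scaleA Lp_scale1 Lp_scaleDr Lp_scaleDl.

Definition Lp_norm (q : Lp_space) : R := fine (Lp_enorm mu p (val (Lp_repr q))).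

Lemma Lp_fun_enorm_fin (f : Lp_fun) : Lp_enorm mu p (val f) \is a fin_num.
Proof.
have /asboolP[_ _ h] : Lp_fun_pred mu p (val f) by exact: (valP f).
by rewrite ge0_fin_numE// Lnorm_ge0.
Qed.

Lemma Lp_enorm_ae (f g : Lp_fun) : {ae mu, forall t, val f t = val g t} ->
  Lp_enorm mu p (val f) = Lp_enorm mu p (val g).
Proof.
have /asboolP[mrf mif _] : Lp_fun_pred mu p (val f) by exact: (valP f).
have /asboolP[mrg mig _] : Lp_fun_pred mu p (val g) by exact: (valP g).
have mf := measurable_rnorm mrf mif; have mg := measurable_rnorm mrg mig.
move=> fg; rewrite /Lp_enorm unlock; congr (_ `^ _)%E.
apply: ae_eq_integral => //.
- exact/(measurableT_comp (measurable_poweR p))/measurableT_comp/measurable_EFinP.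
- exact/(measurableT_comp (measurable_poweR p))/measurableT_comp/measurable_EFinP.
by apply: filterS fg => t -> _.
Qed.

Lemma Lp_norm_class (f : Lp_fun) :
  (Lp_norm (Lp_class f))%:E = Lp_enorm mu p (val f).
Proof.
by rewrite fineK ?Lp_fun_enorm_fin//; exact/Lp_enorm_ae/Lp_repr_class.
Qed.

Lemma Lp_normD (q r : Lp_space) :
  of_real (Lp_norm (q + r)) <= of_real (Lp_norm q) + of_real (Lp_norm r) :> K.
Proof.
rewrite -[q]Lp_reprK -[r]Lp_reprK -Lp_classD -of_realD ler_of_real -lee_fin.
rewrite EFinD !Lp_norm_class; apply: Lp_enormD => //; exact: (valP (Lp_repr _)).
Qed.

Lemma Lp_normZ (a : K) (q : Lp_space) :
  of_real (Lp_norm (a *: q)) = `|a| * of_real (Lp_norm q) :> K.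
Proof.
rewrite -[q]Lp_reprK [_ *: _]Lp_scale_class -of_real_scalar_Re_norm -of_realM.
congr of_real; apply: EFin_inj; rewrite EFinM !Lp_norm_class.
have /asboolP[mr mi _] : Lp_fun_pred mu p (val (Lp_repr q)).
  exact: (valP (Lp_repr q)).
exact: Lp_enormZ.
Qed.

Lemma Lp_norm_eq0 (q : Lp_space) : of_real (Lp_norm q) = 0 :> K -> q = 0.
Proof.
rewrite -(@of_real0 R k) => /of_real_inj; rewrite -[q]Lp_reprK.
have /asboolP[mr mi _] : Lp_fun_pred mu p (val (Lp_repr q)).
  exact: (valP (Lp_repr q)).
have mf := measurable_rnorm mr mi.
move=> q0; have {q0} : Lp_enorm mu p (val (Lp_repr q)) = 0%E.
  by rewrite -Lp_norm_class q0.
move=> /Lnorm_eq0_eq0 h; rewrite -Lp_class0; apply/Lp_class_eq.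
have p0 : (0 < p%:E)%E by rewrite lte_fin (lt_le_trans ltr01).
apply: filterS (h _ p0) => [t /(_ I) [] /rnorm_eq0 //|].
exact/measurable_EFinP.
Qed.

HB.instance Definition _ := Lmodule_isNormed.Build K Lp_space
  Lp_normD Lp_normZ Lp_norm_eq0.

End Lp_space.

Section scalar_topology.
Context {R : realType} {k : scalar_kind}.
Local Notation K := (scalars R k).

Definition imag_unit : K :=
  match k return scalars R k with
  | RealScalars => 0
  | ComplexScalars => Complex 0 1
  end.

Lemma scalar_decomp (z : K) :
  z = of_real (scalar_Re z) + imag_unit * of_real (scalar_Im z).
Proof.
rewrite /imag_unit; move: z; case: k => [z|[a b]] /=; first by rewrite mul0r addr0.
apply/eqP; rewrite eq_complex /=.
by rewrite !(mulr0, mul0r, mul1r, subr0, addr0, add0r) !eqxx.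
Qed.

Lemma ler_norm_scalar_Re (z : K^o) : `|scalar_Re z| <= rnorm z.
Proof.
by rewrite /rnorm [leRHS]scalar_Re_normE -sqrtr_sqr ler_wsqrtr// lerDl sqr_ge0.
Qed.

Lemma ler_norm_scalar_Im (z : K^o) : `|scalar_Im z| <= rnorm z.
Proof.
by rewrite /rnorm [leRHS]scalar_Re_normE -sqrtr_sqr ler_wsqrtr// lerDr sqr_ge0.
Qed.

Lemma rnorm_of_real (a : R) : rnorm (of_real a : K^o) = `|a|.
Proof.
rewrite /rnorm [LHS]scalar_Re_normE of_realK -sqrtr_sqr; congr Num.sqrt.
have -> : scalar_Im (of_real a : K) = 0 by rewrite /of_real; case: k.
by rewrite expr0n addr0.
Qed.

Lemma of_real_continuous : continuous (@of_real R k : R -> K^o).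
Proof.
move=> a; apply/cvgrPdist_lt => e e0.
have e'0 : 0 < scalar_Re e.
  by rewrite -(ltr_of_real (k := k)) of_real0 -[e]gtr0_norm// of_real_scalar_Re_norm
     normr_gt0 gt_eqF.
near=> b.
have -> : of_real a - of_real b = of_real (a - b) :> K^o.
  by apply/eqP; rewrite subr_eq -[X in _ == X]of_realD subrK.
rewrite -of_real_rnorm rnorm_of_real.
have -> : e = of_real (scalar_Re e) by rewrite -[e]gtr0_norm// of_real_scalar_Re_norm.
rewrite ltr_of_real; near: b; exact: cvgr_dist_lt.
Unshelve. all: by end_near. Qed.

Lemma lipschitz_real_continuous (V : normedModType K) (f : V -> R) :
  (forall x y, `|f x - f y| <= rnorm (x - y)) -> continuous f.
Proof.
move=> fl x; apply/cvgrPdist_lt => e e0; near=> y.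
rewrite (le_lt_trans (fl _ _))// -(ltr_of_real (k := k)) of_real_rnorm.
near: y; apply: cvgr_dist_lt; first exact: cvg_id.
by rewrite -(@of_real0 R k) ltr_of_real.
Unshelve. all: by end_near. Qed.

Lemma rnorm_continuous (V : normedModType K) :
  continuous (rnorm : V -> R).
Proof.
apply: lipschitz_real_continuous => x y; rewrite ler_norml lerNl opprB !lerBlDr.
apply/andP; split; last by have := ler_rnormD (x - y) y; rewrite subrK.
by have := ler_rnormD (y - x) x; rewrite subrK -(rnormN (y - x)) opprB.
Qed.

Lemma scalar_Re_continuous : continuous (scalar_Re : K^o -> R).
Proof.
apply: lipschitz_real_continuous => x y.
have := ler_norm_scalar_Re (x - y); rewrite [scalar_Re (x - y)]scalar_ReB.
done.
Qed.

Lemma scalar_Im_continuous : continuous (scalar_Im : K^o -> R).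
Proof.
apply: lipschitz_real_continuous => x y.
have := ler_norm_scalar_Im (x - y); rewrite [scalar_Im (x - y)]scalar_ImB.
done.
Qed.

End scalar_topology.

Section scalar_compactness.
Context {R : realType} {k : scalar_kind}.
Local Notation K := (scalars R k).

Lemma compact_scalar_disc (r : R) : compact [set z : K^o | rnorm z <= r].
Proof.
pose g (ab : R * R) : K^o := of_real ab.1 + imag_unit * of_real ab.2.
have cg : continuous g.
  move=> ab; apply: cvgD.
    by apply: continuous_comp; [exact: cvg_fst|exact: of_real_continuous].
  apply: cvgMr; apply: (continuous_comp (g := @of_real R k : R -> K^o)).
    exact: cvg_snd.
  exact: of_real_continuous.
have cgI : compact (g @` (`[-r, r] `*` `[-r, r])).
  apply: continuous_compact; first exact: continuous_subspaceT.
  by apply: compact_setX; exact: segment_compact.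
apply: subclosed_compact cgI _.
  exact: (closed_comp (fun x _ => @rnorm_continuous R k K^o x) (@closed_le R r)).
move=> z /= zr; exists (scalar_Re z, scalar_Im z); last first.
  by rewrite [RHS]scalar_decomp.
by split; rewrite /= in_itv /= -ler_norml (le_trans _ zr)// ?ler_norm_scalar_Re
  ?ler_norm_scalar_Im.
Qed.

End scalar_compactness.

Section dual_ball.
Context {R : realType} {k : scalar_kind} (E : normedModType (scalars R k)).
Local Notation K := (scalars R k).

(* [{ptws E -> K^o}] carries the topology of pointwise convergence, whose
   trace on the dual of E is the weak* topology. *)
Definition dual_ball_set : set {ptws E -> K^o} :=
  [set phi | [/\ linear (phi : E -> K^o), continuous (phi : E -> K^o) &
    forall x : E, `|x| <= 1 -> `|(phi : E -> K^o) x| <= 1]].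

Definition dual_ball : Type := set_type dual_ball_set.

HB.instance Definition _ := Topological.copy dual_ball (set_type dual_ball_set).

Definition dual_ball_fun (phi : dual_ball) : E -> K^o := val phi.
Coercion dual_ball_fun : dual_ball >-> Funclass.

Lemma dual_ball_set0 : dual_ball_set (cst 0).
Proof.
split; last by move=> x _ /=; rewrite normr0.
- by move=> a x y /=; rewrite scaler0 addr0.
- exact: cst_continuous.
Qed.

HB.instance Definition _ := isPointed.Build dual_ball
  (exist (fun phi : {ptws E -> K^o} => phi \in dual_ball_set) _
    (mem_set dual_ball_set0)).

Lemma dual_ball_setE : dual_ball_set =
  [set phi | linear (phi : E -> K^o)] `&`
  [set phi | forall x : E, rnorm ((phi : E -> K^o) x) <= rnorm x].
Proof.
apply/seteqP; split=> [phi [lphi _ phi1]|phi /= [lphi phi_le]].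
  split=> //= x; pose phil : {linear E -> K^o} :=
    HB.pack (phi : E -> K^o) (GRing.isLinear.Build _ _ _ _ _ lphi).
  have [->|x0] := eqVneq x 0.
    by rewrite -[X in rnorm (X 0)]/(phil : E -> K^o) linear0 !rnorm0.
  have nx0 : `|x| != 0 by rewrite normr_eq0.
  have := phi1 (`|x|^-1 *: x).
  rewrite normrZ normfV normr_id mulVf// => /(_ (lexx _)).
  rewrite -[phi _]/(phil _) linearZ /= normrZ normfV normr_id.
  rewrite mulrC ler_pdivrMr ?normr_gt0// mul1r.
  by rewrite -!of_real_rnorm ler_of_real.
have phi_norm x : `|(phi : E -> K^o) x| <= `|x|.
  by rewrite -!of_real_rnorm ler_of_real; exact: phi_le.
split=> //; last by move=> x; exact: le_trans.
pose phil : {linear E -> K^o} :=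
    HB.pack (phi : E -> K^o) (GRing.isLinear.Build _ _ _ _ _ lphi).
move=> x; apply/cvgrPdist_lt => e e0; near=> y.
rewrite -[phi x]/(phil x) -[phi y]/(phil y) -linearB (le_lt_trans (phi_norm _))//.
Unshelve. all: by end_near. Qed.

Lemma dual_ball_le (phi : dual_ball) (x : E) : rnorm (phi x) <= rnorm x.
Proof.
have : dual_ball_set (dual_ball_fun phi) by exact: (set_mem (valP phi)).
by rewrite dual_ball_setE => -[_]; exact.
Qed.

Lemma dual_ball_eval_continuous (x : E) :
  continuous (fun phi : dual_ball => phi x).
Proof.
move=> phi; apply: (@continuous_comp _ _ _ (set_val : dual_ball -> {ptws E -> K^o})
  (fun f : {ptws E -> K^o} => f x)).
  exact: initial_continuous.
exact: (@proj_continuous E (fun=> K^o) x).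
Qed.

Lemma dual_ball_compact : compact [set: dual_ball].
Proof.
have eval_cont (x : E) :
  continuous (fun f : {ptws E -> K^o} => (f : E -> K^o) x).
  exact: (@proj_continuous E (fun=> K^o) x).
have closed_lin : closed [set phi : {ptws E -> K^o} | linear (phi : E -> K^o)].
  rewrite [X in closed X](_ : _ = \bigcap_(t in [set: K * E * E])
     [set phi : {ptws E -> K^o} | (phi : E -> K^o) (t.1.1 *: t.1.2 + t.2)
       - t.1.1 *: (phi : E -> K^o) t.1.2 - (phi : E -> K^o) t.2 = 0]).
    apply: closed_bigI => t _.
    apply: (@closed_comp {ptws E -> K^o} K^o (fun phi =>
       (phi : E -> K^o) (t.1.1 *: t.1.2 + t.2)
       - t.1.1 *: (phi : E -> K^o) t.1.2 - (phi : E -> K^o) t.2) [set 0]).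
      move=> phi _.
      have h1 := eval_cont (t.1.1 *: t.1.2 + t.2) phi.
      have h2 := cvgZl_tmp (k := t.1.1) (eval_cont t.1.2 phi).
      have {}h2 := h2 (nbhs_filter phi).
      exact: (cvgB (cvgB h1 h2) (eval_cont t.2 phi)).
    apply: accessible_closed_set1; apply: hausdorff_accessible.
    exact: norm_hausdorff.
  apply/seteqP; split=> [phi lphi [[a x] y] _ /=|phi h a x y].
    by rewrite (lphi a x y) addrAC addrK subrr.
  have /= /eqP := h (a, x, y) I.
  by rewrite -addrA -opprD subr_eq0 => /eqP.
have Kc : compact dual_ball_set.
  pose A : set {ptws E -> K^o} :=
    [set phi | forall x : E, rnorm ((phi : E -> K^o) x) <= rnorm x].
  have Ac : compact A.
    apply: (@tychonoff E (fun=> K^o) (fun x => [set z | rnorm z <= rnorm x])).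
    by move=> x; exact: (@compact_scalar_disc R k (rnorm x)).
  apply: (subclosed_compact _ Ac); last by rewrite dual_ball_setE => phi [].
  rewrite dual_ball_setE; apply: closedI => //.
  rewrite [X in closed X](_ : _ = \bigcap_(x in [set: E])
     [set phi : {ptws E -> K^o} | rnorm ((phi : E -> K^o) x) <= rnorm x]).
    apply: closed_bigI => x _.
    apply: (@closed_comp {ptws E -> K^o} R
      (fun phi => rnorm ((phi : E -> K^o) x)) [set r | r <= rnorm x]);
      last exact: closed_le.
    move=> phi _; apply: (@continuous_comp _ _ _
      (fun phi : {ptws E -> K^o} => (phi : E -> K^o) x)); first exact: eval_cont.
    exact: rnorm_continuous.
  by apply/seteqP; split=> [phi h x _|phi h x]; exact: h.
move=> F FF _.
have GF : ProperFilter ((set_val : dual_ball -> {ptws E -> K^o}) @ F).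
  exact: fmap_proper_filter.
have [|phi [phiD clphi]] := Kc _ GF.
  by rewrite /= /fmap /=; apply: filterE => -[psi hpsi]; exact: (set_mem hpsi).
exists (exist (fun phi : {ptws E -> K^o} => phi \in dual_ball_set) phi
  (mem_set phiD)); split=> // A B FA.
rewrite /= nbhsE => -[_ [[V oV <-] Vphi] VB].
have FsA : ((set_val : dual_ball -> {ptws E -> K^o}) @ F)
    [set set_val (psi : dual_ball) | psi in A].
  rewrite /fmap /=; apply: (@filterS dual_ball F _ A _ _ FA) => psi Apsi.
  by exists psi.
have [_ [[psi Apsi <-] Vpsi]] := clphi _ _ FsA (open_nbhs_nbhs (conj oV Vphi)).
by exists psi; split=> //; exact: VB.
Qed.

End dual_ball.

Section evaluation.
Context {R : realType} {k : scalar_kind} (E : normedModType (scalars R k)).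
Local Notation K := (scalars R k).

Definition C_dual_ball : Type := {f : dual_ball E -> K^o | continuous f}.

Definition evaluation (x : E) : C_dual_ball :=
  exist _ (fun phi : dual_ball E => phi x) (@dual_ball_eval_continuous R k E x).

Definition borel (X : topologicalType) : Type := g_sigma_algebraType (@open X).

HB.instance Definition _ (X : ptopologicalType) :=
  Measurable.copy (borel X) (g_sigma_algebraType (@open X)).

Lemma continuous_borel_measurable (X : ptopologicalType) (f : X -> R) :
  continuous f -> measurable_fun [set: borel X] (f : borel X -> R).
Proof.
move=> /continuousP cf; apply: (measurability _ (RGenOpens.measurableE R)).
move=> _ [_ [a [b ->] <-]]; rewrite setTI; apply: sub_sigma_algebra.
exact/cf/interval_open.
Qed.

Definition regular_borel (X : ptopologicalType) (mu : set (borel X) -> \bar R) :=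
  forall A : set (borel X), measurable A ->
    mu A = ereal_inf [set mu U | U in [set U : set X | open U /\ A `<=` U]] /\
    mu A = ereal_sup [set mu C | C in [set C : set X | compact C /\ C `<=` A]].

Context (mu : probability (borel (dual_ball E)) R) {p : R} (p1 : 1 <= p).

Lemma C_dual_ball_Lp (f : C_dual_ball) : sval f \in Lp_pred mu p1.
Proof.
case: f => f cf /=; apply/asboolP.
have cn : continuous (fun phi => rnorm (f phi)).
  move=> phi; apply: (@continuous_comp _ _ _ f (rnorm : K^o -> R)); first exact: cf.
  exact: rnorm_continuous.
have mr : measurable_fun [set: borel (dual_ball E)] (fun t => scalar_Re (f t)).
  apply: continuous_borel_measurable => phi.
  apply: (@continuous_comp _ _ _ f (scalar_Re : K^o -> R)); first exact: cf.
  exact: scalar_Re_continuous.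
have mi : measurable_fun [set: borel (dual_ball E)] (fun t => scalar_Im (f t)).
  apply: continuous_borel_measurable => phi.
  apply: (@continuous_comp _ _ _ f (scalar_Im : K^o -> R)); first exact: cf.
  exact: scalar_Im_continuous.
split=> //.
have /compact_bounded[M [_ bM]] : compact ((fun phi => rnorm (f phi)) @` setT).
  apply: continuous_compact; first exact: continuous_subspaceT.
  exact: dual_ball_compact.
have {}bM phi : rnorm (f phi) <= `|M| + 1.
  rewrite -[leLHS]ger0_norm ?rnorm_ge0//; apply: bM; last by exists phi.
  by rewrite (le_lt_trans (ler_norm M))// ltrDl.
have M0 : 0 <= `|M| + 1 by rewrite addr_ge0.
apply: (@le_lt_trans _ _ (Lnorm mu p%:E (EFin \o cst (`|M| + 1)))).
  apply: le_Lp_enorm => //.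
  - by move=> t; rewrite /= !lee_fin rnorm_ge0 bM.
  - exact/measurable_EFinP/measurable_rnorm.
  exact/measurable_EFinP/measurable_cst.
by have /andP[_ /set_mem] := @Lfun_cst _ _ _ mu (`|M| + 1) p.
Qed.

(* The canonical map j_p; it is well defined because the dual ball is weak*
   compact. *)
Definition Lp_inclusion (f : C_dual_ball) : Lp_space mu p1 :=
  Lp_class (exist (fun g => g \in Lp_pred mu p1) (sval f) (C_dual_ball_Lp f)).

End evaluation.

Section closed_subspace.
Context {K : numFieldType} {V : normedModType K}.

Record closed_subspace := ClosedSubspace {
  csub_pred : {pred V};
  csub_submod : submod_closed csub_pred;
  csub_closed : closed [set x : V | x \in csub_pred] }.

HB.instance Definition _ (G : closed_subspace) :=
  GRing.isSubmodClosed.Build K V (csub_pred G) (csub_submod G).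

Definition csub_type (G : closed_subspace) : Type := {x : V | x \in csub_pred G}.

Context (G : closed_subspace).

HB.instance Definition _ := SubChoice.on (csub_type G).
HB.instance Definition _ := [SubChoice_isSubLmodule of csub_type G by <:].

Definition csub_norm (x : csub_type G) : K := `|val x|.

Lemma csub_normD (x y : csub_type G) :
  csub_norm (x + y) <= csub_norm x + csub_norm y.
Proof. by rewrite /csub_norm raddfD ler_normD. Qed.

Lemma csub_normZ (a : K) (x : csub_type G) :
  csub_norm (a *: x) = `|a| * csub_norm x.
Proof. by rewrite /csub_norm linearZ normrZ. Qed.

Lemma csub_norm_eq0 (x : csub_type G) : csub_norm x = 0 -> x = 0.
Proof. by move=> /normr0_eq0 x0; apply: val_inj; rewrite x0 raddf0. Qed.

HB.instance Definition _ := Lmodule_isNormed.Build K (csub_type G)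
  csub_normD csub_normZ csub_norm_eq0.

Definition csub_elt (x : V) (xG : x \in csub_pred G) : csub_type G :=
  exist (fun y => y \in csub_pred G) x xG.

End closed_subspace.
Arguments csub_elt {K V G x} xG.
Arguments closed_subspace {K} V.
Coercion csub_type : closed_subspace >-> Sortclass.

Definition multilinear (K : numFieldType) (n : nat) (V W : lmodType K)
    (A : ('I_n -> V) -> W) :=
  forall (i : 'I_n) (x : 'I_n -> V), linear (fun u : V => A (dfwith x i u)).

Definition continuous_homogeneous_polynomial (K : numFieldType) (n : nat)
    (E F : normedModType K) (P : E -> F) :=
  continuous P /\
  exists A : ('I_n -> E) -> F, multilinear A /\ forall x, P x = A (fun=> x).

Section dominated.
Context {R : realType} {k : scalar_kind} {E F : normedModType (scalars R k)}.
Context (n : nat) (p : R) (P : E -> F).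

Definition domination_constant (C : R) :=
  0 < C /\
  forall (m : nat) (x : 'I_m -> E), (0 < m)%N ->
    (\sum_(j < m) rnorm (P (x j)) `^ (p / n%:R)) `^ (n%:R / p) <=
    C * sup [set (\sum_(j < m) rnorm (phi (x j)) `^ p) `^ (n%:R / p)
            | phi in [set: dual_ball E]].

Definition p_dominated := exists C, domination_constant C.

Definition dominated_norm : R := inf [set C | domination_constant C].

End dominated.

Section symmetric_tensor.
Context {R : realType} {k : scalar_kind} (n : nat) (G : normedModType (scalars R k)).
Local Notation K := (scalars R k).

(* The n-fold tensor product of G is realized inside the algebraic dual of the
   space of all (not necessarily continuous) n-linear forms on G:
   x_1 (x) ... (x) x_n is the functional A |-> A(x_1, ..., x_n). The symmetric
   tensors are the linear span of the x (x) ... (x) x. *)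
Definition multilinear_form : Type :=
  {A : ('I_n -> G) -> K^o | multilinear A}.

Definition diagonal_functional (x : G) : multilinear_form -> K^o :=
  fun A => sval A (fun=> x).

Definition sym_tensor_pred : {pred multilinear_form -> K^o} := fun theta =>
  `[< exists m (lambda : 'I_m -> K) (x : 'I_m -> G),
      theta = \sum_(i < m) lambda i *: diagonal_functional (x i) >].

Lemma sym_tensor_submod_closed : submod_closed sym_tensor_pred.
Proof.
split.
  by apply/asboolP; exists 0, (fun=> 0), (fun=> 0); rewrite big_ord0.
move=> a _ _ /asboolP[m [l [x ->]]] /asboolP[m' [l' [x' ->]]]; apply/asboolP.
pose glue T (u : 'I_m -> T) (v : 'I_m' -> T) (i : 'I_(m + m')) :=
  match fintype.split i with inl j => u j | inr j => v j end.
exists (m + m')%N, (glue K (fun j => a * l j) l'), (glue G x x').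
rewrite big_split_ord scaler_sumr; congr (_ + _); apply: eq_bigr => i _.
  by rewrite /glue (unsplitK (inl i)) scalerA.
by rewrite /glue (unsplitK (inr i)).
Qed.

HB.instance Definition _ := GRing.isSubmodClosed.Build K (multilinear_form -> K^o)
  sym_tensor_pred sym_tensor_submod_closed.

Definition sym_tensor : Type :=
  {theta : multilinear_form -> K^o | theta \in sym_tensor_pred}.

HB.instance Definition _ := SubChoice.on sym_tensor.
HB.instance Definition _ := [SubChoice_isSubLmodule of sym_tensor by <:].

Lemma diagonal_functional_sym (x : G) : diagonal_functional x \in sym_tensor_pred.
Proof.
by apply/asboolP; exists 1, (fun=> 1), (fun=> x); rewrite big_ord1 scale1r.
Qed.

Definition diag_tensor (x : G) : sym_tensor :=
  exist (fun theta => theta \in sym_tensor_pred) _ (diagonal_functional_sym x).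

Definition proj_s_norm (theta : sym_tensor) : R :=
  inf [set s | exists m (lambda : 'I_m -> K) (x : 'I_m -> G),
    theta = \sum_(i < m) lambda i *: diag_tensor (x i) /\
    s = \sum_(i < m) rnorm (lambda i : K^o) * rnorm (x i) ^+ n].

Context {F : normedModType (scalars R k)}.

(* Continuity of v for the topology of the norm [proj_s_norm]. *)
Definition proj_s_continuous (v : sym_tensor -> F) :=
  forall (theta : sym_tensor) (e : R), 0 < e ->
    exists2 d : R, 0 < d & forall theta' : sym_tensor,
      proj_s_norm (theta' - theta) < d -> rnorm (v theta' - v theta) < e.

Definition proj_s_opnorm (v : sym_tensor -> F) : R :=
  sup [set rnorm (v theta) | theta in [set theta | proj_s_norm theta <= 1]].

End symmetric_tensor.

(* Main.v *)
Require Import Defs.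
From HB Require Import structures.
From mathcomp Require Import all_boot all_order all_algebra.
From mathcomp Require Import ring lra.
From mathcomp Require Import complex finmap.
From mathcomp Require Import all_classical all_reals all_analysis.
From mathcomp Require Import measurable_realfun.

Set Implicit Arguments.
Unset Strict Implicit.
Unset Printing Implicit Defensive.

Import Order.TTheory GRing.Theory Num.Theory.
Import numFieldNormedType.Exports.

Local Open Scope classical_set_scope.
Local Open Scope ring_scope.

(** Put [q = p / n] and let [X] be the dual ball, a compact Hausdorff space.
    The theorem is a Pietsch domination theorem followed by a linearization.

    Domination.  Since [P] is [n]-homogeneous, the finite sums of functions
    [phi |-> C^q |phi x|^p - |P x|^q], with [x] ranging over [E], form a convex
    cone of bounded functions on [X], and domination with constant [C] means that
    no function of this cone is bounded above by a negative number
    ([domination_cone_gt]).  Applying the Hahn-Banach theorem to the sublinear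
    functional [f |-> inf_g sup (f + g)], [g] in the cone, gives a mean on all
    bounded functions which is nonnegative on the cone ([mean_of_cone]).  On
    indicators this mean is a finitely additive probability defined on all
    subsets of [X]; approximating from inside by closed sets and from outside by
    open sets turns it into a regular Borel probability [mu], which is at least
    as large on closed sets.  Slicing a function along its superlevel sets then
    shows that the [mu]-integral of an upper semicontinuous nonnegative function
    is at least its mean ([mean_regular_probability]).  This one-sided comparison
    is all that is needed to get [|P x| <= C ||J x||^n], where [J x] is the class
    of the evaluation at [x] in [L_p(mu)] ([pietsch_domination]).  The
    infimum of the admissible constants still satisfies the domination
    inequality, so [C] can be taken to be [||P||_{d,p}].

    Linearization.  By polarization, the symmetric [n]-linear map associated with
    [P] is bounded for the seminorm [||J x||] ([symmetrize_bounded]), so it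
    extends to an [n]-linear map [A] on the closure [G] of [J E]
    ([multilinear_extension]), and [|A (g, ..., g)| <= C ||g||^n] by density.  A
    symmetric tensor [theta] is a functional on [n]-linear forms; its image
    [v theta] is the only vector that every linear functional [l] of [F] sends to
    [theta (l o A)] ([linearization]).  The bound on the diagonal gives
    [|v theta| <= C pi_s(theta)].

    Conversely, a bound [|P x| <= M ||J x||^n] with any probability measure makes
    [M] an admissible domination constant, because an integral is at most the
    supremum of the integrand ([domination_of_bound]).  Applied to a continuous
    [v] this proves the converse implication, and applied to [M = ||v|| + e] it
    proves [||P||_{d,p} <= ||v||]. *)

(** * Sublinear functionals and the Hahn-Banach theorem *)

Section hahn_banach.
Context {R : realType} {V : lmodType R}.
Implicit Types (q : V -> R) (x y : V).

Definition sublinear q :=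
  (forall x y, q (x + y) <= q x + q y) /\
  (forall a x, 0 < a -> q (a *: x) <= a * q x).

Lemma sublinearZ q a x : sublinear q -> 0 < a -> q (a *: x) = a * q x.
Proof.
move=> [_ qZ] a0; apply/eqP; rewrite eq_le qZ//=.
have := qZ a^-1 (a *: x); rewrite invr_gt0 scalerA mulVf ?gt_eqF// scale1r.
by move=> /(_ a0); rewrite mulrC ler_pdivlMr// mulrC.
Qed.

Lemma sublinear0 q : sublinear q -> q 0 = 0.
Proof.
move=> sq; have := sublinearZ 0 sq (@ltr0Sn R 1); rewrite scaler0.
by move=> h; lra.
Qed.

Lemma sublinear_geN q x : sublinear q -> - q (- x) <= q x.
Proof.
move=> sq; have := sq.1 x (- x); rewrite subrr sublinear0// => h; lra.
Qed.

(** The infimum of [q (x + t y) - t q y] over [t >= 0] is the step of the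
    classical proof by which a minimal sublinear functional is shown to be
    additive: if nothing lies strictly below [q], then taking [t = 1] gives
    [q x + q y <= q (x + y)]. It also forces a linear functional below it to
    take the value [q y] at [y]. *)
Lemma sublinear_slide q y : sublinear q -> exists2 r, sublinear r &
  forall x, r x <= q x /\ r x <= q (x + y) - q y.
Proof.
move=> sq.
pose S z := [set q (z + t *: y) - t * q y | t in [set t : R | 0 <= t]].
have qt t : 0 <= t -> q (t *: y) = t * q y.
  rewrite le_eqVlt => /orP[/eqP <-|]; last exact: sublinearZ.
  by rewrite scale0r mul0r sublinear0.
have Slb z : lbound (S z) (- q (- z)).
  move=> _ [t t0 <-].
  have := sq.1 (z + t *: y) (- z); rewrite addrAC subrr add0r qt// => h; lra.
have S0 z : S z !=set0 by exists (q (z + 0 *: y) - 0 * q y), 0 => /=.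
have iS z t : 0 <= t -> inf (S z) <= q (z + t *: y) - t * q y.
  by move=> t0; apply: ge_inf; [exists (- q (- z))|exists t].
exists (fun z => inf (S z)).
  split=> [z1 z2|a z a0].
    rewrite -lerBlDr; apply: lb_le_inf => // _ [s s0 <-].
    rewrite lerBlDr -lerBlDl; apply: lb_le_inf => // _ [t t0 <-].
    rewrite lerBlDl (le_trans (iS _ _ (addr_ge0 s0 t0)))//.
    have := sq.1 (z1 + s *: y) (z2 + t *: y).
    by rewrite addrACA -scalerDl => h; lra.
  rewrite mulrC -ler_pdivrMr//; apply: lb_le_inf => // _ [t t0 <-].
  rewrite ler_pdivrMr// (le_trans (iS _ _ (mulr_ge0 (ltW a0) t0)))//.
  by rewrite -scalerA -scalerDr sublinearZ//; lra.
move=> x; have := iS x 0 (lexx _); have := iS x 1 ler01.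
by rewrite scale0r addr0 mul0r subr0 scale1r mul1r.
Qed.

(** Zorn's lemma: the infimum of a chain is sublinear because two members
    of the chain are comparable, and it is finite because every sublinear
    functional [s] below [q] satisfies [- q (- x) <= s x]. *)
Lemma sublinear_minimal q : sublinear q -> exists2 r, sublinear r &
  (forall x, r x <= q x) /\
  (forall q', sublinear q' -> (forall z, q' z <= r z) -> forall z, r z <= q' z).
Proof.
move=> sq.
pose T := {r : V -> R | sublinear r /\ forall x, r x <= q x}.
pose leT (s t : T) := `[< forall x, sval t x <= sval s x >].
have t0 : T by exists q.
have [||A totA|[r [sr rq]] rmin] := @ZL_preorder T t0 leT.
- by move=> t; apply/asboolP.
- move=> r s t /asboolP rs /asboolP st; apply/asboolP => x.
  exact: le_trans (st x) (rs x).
- have [[a Aa]|A0] := pselect (A !=set0); last first.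
    by exists t0 => s As; case: A0; exists s.
  pose S x := [set sval s x | s in A].
  have S0 x : S x !=set0 by exists (sval a x), a.
  have iS s x : A s -> inf (S x) <= sval s x.
    move=> As; apply: ge_inf; last by exists s.
    exists (- q (- x)) => _ [u Au <-]; case: u Au => u [su uq] _ /=.
    by rewrite (le_trans _ (sublinear_geN x su))// lerN2.
  have sS : sublinear (fun x => inf (S x)).
    split=> [x y|c x c0].
      rewrite -lerBlDr; apply: lb_le_inf => // _ [s As <-].
      rewrite lerBlDr -lerBlDl; apply: lb_le_inf => // _ [t At <-].
      rewrite lerBlDl; have [/asboolP st|/asboolP st] := totA s t As At.
        rewrite (le_trans (iS t _ At))// (le_trans ((svalP t).1.1 x y))//.
        by rewrite lerD2r.
      rewrite (le_trans (iS s _ As))// (le_trans ((svalP s).1.1 x y))//.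
      by rewrite lerD2l.
    rewrite mulrC -ler_pdivrMr//; apply: lb_le_inf => // _ [s As <-].
    rewrite ler_pdivrMr// (le_trans (iS s _ As))// mulrC.
    exact: (svalP s).1.2.
  have Sq x : inf (S x) <= q x := le_trans (iS a x Aa) ((svalP a).2 x).
  pose w : T := exist _ (fun x => inf (S x)) (conj sS Sq).
  by exists w => s As; apply/asboolP => x /=; exact: iS.
exists r => //; split=> // q' sq' q'r z.
have q'q x : q' x <= q x := le_trans (q'r x) (rq x).
pose w : T := exist _ q' (conj sq' q'q).
by have /asboolP := rmin w (asboolT q'r); exact.
Qed.

(** A minimal sublinear functional is linear. Minimizing below the slide of
    [q] along [y], rather than below [q] itself, is what gives [L y = q y]. *)
Theorem hahn_banach q y : sublinear q ->
  exists2 L : {linear V -> R^o}, forall x, L x <= q x & L y = q y.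
Proof.
move=> sq; have [qy /sublinear_minimal[r sr [rqy rmin]] qyE] := sublinear_slide y sq.
have rD x z : r (x + z) = r x + r z.
  apply/le_anti/andP; split; first exact: sr.1.
  have [rz srz rzE] := sublinear_slide z sr.
  have := rmin _ srz (fun t => (rzE t).1) x; have := (rzE x).2; lra.
have rN x : r (- x) = - r x.
  by apply/eqP; rewrite -addr_eq0 -rD addNr sublinear0.
have rZ a x : r (a *: x) = a * r x.
  have [a0|a0|->] := ltgtP a 0; last by rewrite scale0r mul0r sublinear0.
    by rewrite -[a]opprK scaleNr rN sublinearZ ?oppr_gt0// [in RHS]mulNr.
  exact: sublinearZ.
have lr : linear (r : V -> R^o) by move=> a x z; rewrite rD rZ.
pose L : {linear V -> R^o} :=
  HB.pack (r : V -> R^o) (GRing.isLinear.Build _ _ _ _ _ lr).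
have rq x : r x <= q x := le_trans (rqy x) (qyE x).1.
exists L => //; apply/le_anti/andP; split; first exact: rq.
have := le_trans (rqy (- y)) (qyE (- y)).2.
by rewrite addNr sublinear0// rN sub0r lerN2.
Qed.

End hahn_banach.

(** * Linear functionals separate points *)

Section separating_functional.
Context {R : realType} {k : scalar_kind}.
Local Notation K := (scalars R k).

Lemma of_real1 : of_real 1 = 1 :> K.
Proof. by case: k. Qed.

(** Restriction of scalars to the reals, on an alias of the module so that the
    two scalar actions do not compete. *)
Definition realified (F : lmodType K) : Type := F.

HB.instance Definition _ (F : lmodType K) := GRing.Zmodule.on (realified F).

Definition realified_scale (F : lmodType K) (a : R) (x : realified F) :
  realified F := (of_real a : K) *: (x : F).

Section realified_module.
Variable F : lmodType K.
Local Notation rscale := (@realified_scale F).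

Lemma realified_scaleA a b x : rscale a (rscale b x) = rscale (a * b) x.
Proof. by rewrite /realified_scale scalerA of_realM. Qed.

Lemma realified_scale1 : left_id 1 rscale.
Proof. by move=> x; rewrite /realified_scale of_real1 scale1r. Qed.

Lemma realified_scaleDr : right_distributive rscale +%R.
Proof. by move=> a x y; rewrite /realified_scale scalerDr. Qed.

Lemma realified_scaleDl x : {morph rscale^~ x : a b / a + b}.
Proof. by move=> a b; rewrite /realified_scale of_realD scalerDl. Qed.

HB.instance Definition _ := GRing.Zmodule_isLmodule.Build R (realified F)
  realified_scaleA realified_scale1 realified_scaleDr realified_scaleDl.

End realified_module.

Lemma sublinear_rnorm (F : normedModType K) :
  sublinear (rnorm : realified F -> R).
Proof.
split=> [x y|a x a0]; first exact: ler_rnormD.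
by rewrite [a *: x]/(realified_scale a x) rnormZ rnorm_of_real gtr0_norm.
Qed.

End separating_functional.

(** The usual complexification [L x - i L (i x)] of a real functional. With
    real scalars [imag_unit] is [0] and the formula returns [L] itself, so that
    one expression serves both kinds of scalars. *)
Lemma complexify_linear (R : realType) (k : scalar_kind)
    (F : lmodType (scalars R k)) (L : {linear realified F -> R^o}) :
  linear (fun x : F =>
    of_real (L x) - imag_unit * of_real (L (imag_unit *: x)) : (scalars R k)^o).
Proof.
move: F L; rewrite /imag_unit; case: k => F L a x y.
  rewrite !mul0r !subr0 -[a *: x]/((a : R) *: (x : realified F)).
  by rewrite linearP.
have LZ (b : R) (z : F) :
    L ((of_real b : scalars R ComplexScalars) *: z) = b * L z.
  by rewrite -[LHS]/(L (b *: (z : realified F))) linearZ.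
have LD (z w : F) : L (z + w) = L z + L w.
  by rewrite -[LHS]/(L ((z : realified F) + w)) linearD.
pose i : scalars R ComplexScalars := Complex 0 1.
have ii : i * i = - 1.
  by apply/eqP; rewrite eq_complex /=; apply/andP; split; apply/eqP; ring.
have La (z : F) : L (a *: z) = complex.Re a * L z + complex.Im a * L (i *: z).
  rewrite {1}[a](scalar_decomp (a : scalars R ComplexScalars)) scalerDl LD LZ.
  by rewrite [_ * of_real _]mulrC -scalerA LZ.
have iE (u v : R) :
    of_real u - i * of_real v = Complex u (- v) :> scalars R ComplexScalars.
  by apply/eqP; rewrite eq_complex /=; apply/andP; split; apply/eqP; ring.
rewrite !iE scalerDr !LD scalerA [i * a]mulrC -scalerA !La !scalerA ii scaleN1r.
have LN (z : F) : L (- z) = - L z.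
  by rewrite -[LHS]/(L (- (z : realified F))) linearN.
rewrite LN; case: a {La} => a b.
by apply/eqP; rewrite eq_complex /=; apply/andP; split; apply/eqP; ring.
Qed.

(** A norming functional does not vanish at a nonzero vector. *)
Lemma separating_functional (R : realType) (k : scalar_kind)
    (F : normedModType (scalars R k)) (y : F) :
  (forall l : {linear F -> (scalars R k)^o}, l y = 0) -> y = 0.
Proof.
move=> ly; apply: rnorm_eq0.
have [L _ <-] := @hahn_banach R (realified F) _ y (@sublinear_rnorm R k F).
pose l : {linear F -> (scalars R k)^o} :=
  HB.pack (fun x : F =>
    of_real (L x) - imag_unit * of_real (L (imag_unit *: x)) : (scalars R k)^o)
  (GRing.isLinear.Build _ _ _ _ _ (complexify_linear L)).
have := congr1 scalar_Re (ly l); rewrite /= scalar_ReB of_realK.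
rewrite scalar_ReM of_realK.
have -> : scalar_Re (imag_unit : scalars R k) = 0 by rewrite /imag_unit; case: (k).
have Im0 (b : R) : scalar_Im (of_real b : scalars R k) = 0 by case: (k).
rewrite Im0 mul0r mulr0 subrr subr0 => ->; by case: (k).
Qed.

(** * Means on bounded functions *)

Section mean.
Context {R : realType} {X : Type}.

Definition bounded_fun : {pred X -> R^o} :=
  fun f => `[< exists M : R, forall x, `|f x| <= M >].

Lemma bounded_fun_submod_closed : submod_closed bounded_fun.
Proof.
split; first by apply/asboolP; exists 0 => x; rewrite normr0.
move=> a f g /asboolP[M fM] /asboolP[N gN]; apply/asboolP.
exists (`|a| * M + N) => x; rewrite (le_trans (ler_normD _ _))// lerD//.
by rewrite normrM ler_wpM2l.
Qed.

HB.instance Definition _ := GRing.isSubmodClosed.Build R (X -> R^o)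
  bounded_fun bounded_fun_submod_closed.

Lemma bounded_cst (c : R) : (cst c : X -> R) \in bounded_fun.
Proof. by apply/asboolP; exists `|c|. Qed.

Lemma bounded_indic (A : set X) : (\1_A : X -> R) \in bounded_fun.
Proof.
by apply/asboolP; exists 1 => x; rewrite indicE ger0_norm ?ler0n// lern1 leq_b1.
Qed.

Lemma bounded_scale (a : R) (f : X -> R) :
  f \in bounded_fun -> (fun x => a * f x) \in bounded_fun.
Proof. by move=> fb; exact: (@rpredZ _ _ _ a (f : X -> R^o)). Qed.

Lemma bounded_add (f g : X -> R) : f \in bounded_fun -> g \in bounded_fun ->
  f \+ g \in bounded_fun.
Proof. by move=> fb gb; exact: (@rpredD _ _ (f : X -> R^o)). Qed.

Definition bounded_fun_type : Type := {f : X -> R^o | f \in bounded_fun}.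

HB.instance Definition _ := SubChoice.on bounded_fun_type.
HB.instance Definition _ := [SubChoice_isSubLmodule of bounded_fun_type by <:].

(** A finitely additive integral of total mass one: the last clause, applied to
    [f] and to its opposite, expresses both positivity and normalization. *)
Definition mean (L : (X -> R) -> R) :=
  [/\ forall f g, f \in bounded_fun -> g \in bounded_fun -> L (f \+ g) = L f + L g,
      forall a f, f \in bounded_fun -> L (fun x => a * f x) = a * L f &
      forall f c, f \in bounded_fun -> (forall x, f x <= c) -> L f <= c].

(** The functional [q f], the infimum of the suprema of [f + g] for [g] in the
    cone, is finite because no member of the cone is bounded above by a negative
    number. It is at most the supremum of [f], so that a linear [L] below it is a
    mean, and it is at most [0] at [- g], so that [L] is nonnegative on the
    cone. *)
Lemma mean_of_cone (C : set (X -> R)) :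
  (forall g, C g -> g \in bounded_fun) ->
  C (cst 0) ->
  (forall f g, C f -> C g -> C (f \+ g)) ->
  (forall (a : R) f, 0 < a -> C f -> C (fun x => a * f x)) ->
  (forall g (e : R), C g -> 0 < e -> exists x, - e < g x) ->
  exists L, mean L /\ forall g, C g -> 0 <= L g.
Proof.
move=> Cb C0 CD CZ Cge.
pose S (f : bounded_fun_type) :=
  [set c : R | exists2 g, C g & forall x, val f x + g x <= c].
pose q f := inf (S f).
have Slb f : exists M, lbound (S f) (- M).
  have /asboolP[M fM] := valP f; exists M => c [g Cg gc].
  rewrite leNgt; apply/negP => cM.
  have [|x gx] := Cge g (- M - c) Cg; first by rewrite subr_gt0.
  have := fM x; rewrite ler_norml => /andP[fx _].
  by have := lt_le_trans (ler_ltD fx gx) (gc x); rewrite opprB addrCA subrr addr0 ltxx.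
have Shl f : has_lbound (S f) by have [M] := Slb f; exists (- M).
have S0 f : S f !=set0.
  have /asboolP[M fM] := valP f; exists M, (cst 0) => // x.
  by rewrite addr0 (le_trans (ler_norm _)).
have sq : sublinear q.
  split=> [f g|a f a0].
    rewrite -lerBlDr; apply: lb_le_inf => // c [u Cu uc].
    rewrite lerBlDr -lerBlDl; apply: lb_le_inf => // d [v Cv vd].
    rewrite lerBlDl; apply: ge_inf => //; exists (u \+ v); first exact: CD.
    move=> x; rewrite -[leLHS]/((val f x + val g x) + (u x + v x)) addrACA.
    exact: lerD (uc x) (vd x).
  rewrite mulrC -ler_pdivrMr//; apply: lb_le_inf => // c [u Cu uc].
  rewrite ler_pdivrMr//; apply: ge_inf => //.
  exists (fun x => a * u x); first exact: CZ.
  move=> x; rewrite -[leLHS]/(a * val f x + a * u x) -mulrDr mulrC.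
  by apply: ler_wpM2r; [exact: ltW|exact: uc].
have [L Lq _] := hahn_banach 0 sq.
pose bf (f : X -> R) (fb : f \in bounded_fun) : bounded_fun_type :=
  exist (fun g : X -> R^o => g \in bounded_fun) f fb.
pose Lx (f : X -> R) := if insub f is Some g then L g else 0.
have LxE f (fb : f \in bounded_fun) : Lx f = L (bf f fb).
  by rewrite /Lx insubT; congr (L _); exact: val_inj.
exists Lx; split; last first.
  move=> g Cg; rewrite (LxE _ (Cb _ Cg)) -oppr_le0 -linearN.
  rewrite (le_trans (Lq _))//; apply: ge_inf => //; exists g => // x /=.
  by rewrite addNr.
split=> [f g fb gb|a f fb|f c fb fc].
- have fgb : (f : X -> R^o) + g \in bounded_fun by exact: rpredD.
  rewrite (LxE _ fb) (LxE _ gb) (LxE _ fgb) -linearD; congr (L _).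
  exact: val_inj.
- have afb : a *: (f : X -> R^o) \in bounded_fun by exact: rpredZ.
  rewrite (LxE _ fb) (LxE _ afb) -[RHS]linearZ; congr (L _).
  exact: val_inj.
- rewrite (LxE _ fb) (le_trans (Lq _))//; apply: ge_inf => //.
  by exists (cst 0) => // x /=; rewrite addr0.
Qed.

End mean.

(** * Regularization of a finitely additive probability *)

Section regularization.
Local Open Scope ereal_scope.
Context {R : realType} {X : ptopologicalType}.
Variable nu : set X -> R.
Hypotheses (Xh : hausdorff_space X) (Xc : compact [set: X]).
Hypotheses (nu_setT : nu setT = 1%R) (nu_set0 : nu set0 = 0%R).
Hypothesis nu_mono : forall A B, A `<=` B -> (nu A <= nu B)%R.
Hypothesis nuU : forall A B, A `&` B = set0 -> nu (A `|` B) = (nu A + nu B)%R.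

Let nuU_le A B : (nu (A `|` B) <= nu A + nu B)%R.
Proof.
have -> : A `|` B = A `|` (B `\` A) by rewrite setUDr setDv setD0.
rewrite nuU; first by rewrite lerD2l; apply: nu_mono; exact: subDsetl.
by rewrite setDE setICA setICr setI0.
Qed.

Definition inner_content (U : set X) : \bar R :=
  ereal_sup [set (nu C)%:E | C in [set C | closed C /\ C `<=` U]].

(** The outer measure of Riesz's representation theorem, with the values of
    [nu] on closed sets in place of those of a positive functional on continuous
    functions. *)
Definition regular_outer (A : set X) : \bar R :=
  ereal_inf [set inner_content U | U in [set U | open U /\ A `<=` U]].

Lemma le_inner_content C U : closed C -> C `<=` U -> (nu C)%:E <= inner_content U.
Proof. by move=> cC CU; apply: ereal_sup_ubound; exists C. Qed.

Lemma inner_content_mono U V : U `<=` V -> inner_content U <= inner_content V.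
Proof.
move=> UV; apply: ge_ereal_sup => _ [C [cC CU] <-].
by apply: le_inner_content => //; exact: subset_trans CU UV.
Qed.

Lemma inner_content_ge0 U : 0 <= inner_content U.
Proof. by rewrite (le_trans _ (le_inner_content (@closed0 X) _))// nu_set0. Qed.

Lemma inner_content_le1 U : inner_content U <= 1.
Proof. by apply: ge_ereal_sup => _ [C _ <-]; rewrite lee_fin -nu_setT nu_mono. Qed.

(** By normality, a closed subset of [U `|` V] is the union of a closed subset
    of [U] and a closed subset of [V]: remove disjoint open neighborhoods of its
    parts outside [U] and outside [V]. *)
Lemma inner_contentU U V : open U -> open V ->
  inner_content (U `|` V) <= inner_content U + inner_content V.
Proof.
move=> oU oV; apply: ge_ereal_sup => _ [C [cC CUV] <-].
have clD (W : set X) : open W -> closed (C `\` W).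
  by move=> oW; rewrite setDE; apply: closedI => //; exact: open_closedC.
have /(@normal_openP R) nX := compact_normal Xh Xc.
have [|A [B [oA oB UA VB AB0]]] := nX (C `\` U) (C `\` V) (clD _ oU) (clD _ oV).
  by rewrite -setDUr setD_eq0.
have CE : C `<=` (C `\` A) `|` (C `\` B).
  move=> x Cx; have [Ax|nAx] := pselect (A x); last by left.
  right; split=> // Bx; have : (A `&` B) x by [].
  by rewrite AB0.
have CA_ U' A' : C `\` U' `<=` A' -> C `\` A' `<=` U'.
  by move=> h x [Cx nAx]; apply: contrapT => nUx; apply: nAx; exact: h.
apply: (@le_trans _ _ ((nu (C `\` A))%:E + (nu (C `\` B))%:E)).
  by rewrite -EFinD lee_fin (le_trans (nu_mono CE)).
by apply: leeD; apply: le_inner_content; [exact: clD|exact: CA_|exact: clD|exact: CA_].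
Qed.

(** Compactness reduces a countable cover of a closed set to a finite one. *)
Lemma inner_content_bigcup (U : (set X)^nat) : (forall i, open (U i)) ->
  inner_content (\bigcup_i U i) <= \sum_(i <oo) inner_content (U i).
Proof.
move=> oU; apply: ge_ereal_sup => _ [C [cC CU] <-].
have : compact C by apply: (subclosed_compact cC Xc).
rewrite compact_cover => /(_ nat setT U) [|//|D _ CD]; first by move=> i _; exact: oU.
pose m := (\max_(i <- enum_fset D) i).+1.
have {CD} CUm : C `<=` \big[setU/set0]_(i < m) U i.
  move=> x /CD[i /= iD Ux]; rewrite -bigcup_mkord; exists i => //=.
  by rewrite ltnS; exact: leq_bigmax_seq.
apply: le_trans (nneseries_lim_ge m _); last by move=> *; exact: inner_content_ge0.
apply: le_trans (le_inner_content cC CUm) _; rewrite big_mkord.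
suff h k : open (\big[setU/set0]_(i < k) U i) /\
  inner_content (\big[setU/set0]_(i < k) U i) <= \sum_(i < k) inner_content (U i).
  exact: (h m).2.
elim: k => [|k [ok IH]].
  rewrite !big_ord0; split; first exact: open0.
  by apply: ge_ereal_sup => _ [D' [_ C0] <-]; move: C0;
    rewrite subset0 => ->; rewrite nu_set0.
rewrite !big_ord_recr /=; split; first exact: openU.
by rewrite (le_trans (inner_contentU ok (oU k)))// leeD2r.
Qed.

Lemma regular_outer_le A U : open U -> A `<=` U -> regular_outer A <= inner_content U.
Proof. by move=> oU AU; apply: ereal_inf_lbound; exists U. Qed.

Lemma regular_outer_open U : open U -> regular_outer U = inner_content U.
Proof.
move=> oU; apply/le_anti/andP; split; first exact: regular_outer_le.
by apply: le_ereal_inf_tmp => _ [V [_ UV] <-]; exact: inner_content_mono.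
Qed.

Lemma regular_outer_ge0 A : 0 <= regular_outer A.
Proof. by apply: le_ereal_inf_tmp => _ [V _ <-]; exact: inner_content_ge0. Qed.

Lemma regular_outer_le1 A : regular_outer A <= 1.
Proof. exact: le_trans (regular_outer_le (@openT X) _) (inner_content_le1 _). Qed.

Lemma regular_outer_fin A : regular_outer A \is a fin_num.
Proof.
by rewrite ge0_fin_numE ?regular_outer_ge0// (le_lt_trans (regular_outer_le1 A))// ltry.
Qed.

Lemma regular_outer_mono : {homo regular_outer : A B / A `<=` B >-> A <= B}.
Proof.
move=> A B AB; apply: le_ereal_inf_tmp => _ [V [oV BV] <-].
by apply: regular_outer_le => //; exact: subset_trans BV.
Qed.

Lemma regular_outer0 : regular_outer set0 = 0.
Proof.
rewrite regular_outer_open; last exact: open0.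
apply/le_anti; rewrite inner_content_ge0 andbT.
by apply: ge_ereal_sup => _ [C [_ C0] <-]; move: C0;
  rewrite subset0 => ->; rewrite nu_set0.
Qed.

Lemma regular_outer_adherent A (e : R) : (0 < e)%R -> exists U,
  [/\ open U, A `<=` U & inner_content U <= regular_outer A + e%:E].
Proof.
move=> e0; have [_ [U [oU AU] <-] /ltW h] :=
  lb_ereal_inf_adherent e0 (regular_outer_fin A).
by exists U.
Qed.

Lemma regular_outer_sigma_subadditive : sigma_subadditive regular_outer.
Proof.
move=> F; apply/lee_addgt0Pr => e e0.
have /choice[U UP] n : exists U, [/\ open U, F n `<=` U &
    inner_content U <= regular_outer (F n) + (e / (2 ^ n.+1)%:R)%:E].
  by apply: regular_outer_adherent; rewrite divr_gt0// ltr0n expn_gt0.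
have oU i : open (U i) by case: (UP i).
apply: le_trans (epsilon_trick _ _ (ltW e0)); last first.
  by move=> n; exact: regular_outer_ge0.
apply: (@le_trans _ _ (\sum_(i <oo) inner_content (U i))).
  apply: le_trans (inner_content_bigcup oU); apply: regular_outer_le.
    by apply: bigcup_open => i _.
  by apply: subset_bigcup => i _; case: (UP i).
apply: lee_nneseries => [i _ _|i _]; first exact: inner_content_ge0.
by case: (UP i).
Qed.

HB.instance Definition _ := isOuterMeasure.Build R X regular_outer
  regular_outer0 regular_outer_ge0 regular_outer_mono
  regular_outer_sigma_subadditive.

(** For an open [V], choose a closed [C] in [V `&` U] of nearly full content, then
    a closed set in the open set [V `\` C], which contains [V `\` U]. The two
    closed sets are disjoint, so finite additivity of [nu] bounds the sum of
    their masses by the content of [V]. *)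
Lemma open_caratheodory U : open U -> caratheodory_measurable regular_outer U.
Proof.
move=> oU; apply: le_caratheodory_measurable => A.
apply: le_ereal_inf_tmp => _ [V [oV AV] <-].
apply: (@le_trans _ _ (inner_content (V `&` U) + regular_outer (V `\` U))).
  apply: leeD; last by apply: regular_outer_mono; rewrite -setDE; exact: setSD.
  by apply: regular_outer_le; [exact: openI|exact: setSI].
rewrite -leeBrDr; last exact: regular_outer_fin.
apply: ge_ereal_sup => _ [C [cC CVU] <-].
rewrite leeBrDr; last exact: regular_outer_fin.
rewrite addeC -leeBrDr//.
have oVC : open (V `\` C).
  by rewrite setDE; apply: openI => //; exact: closed_openC.
apply: (@le_trans _ _ (inner_content (V `\` C))).
  apply: regular_outer_le => //; apply: setDS => x /CVU[]; done.
apply: ge_ereal_sup => _ [D [cD DVC] <-]; rewrite leeBrDr// -EFinD.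
rewrite -nuU; last first.
  by rewrite -subset0 => x [/DVC[_ +] ].
apply: le_inner_content; first exact: closedU.
by rewrite subUset; split=> x; [move=> /DVC[]|move=> /CVU[]].
Qed.

Definition regular_measure : set (borel X) -> \bar R := regular_outer.

Lemma borel_caratheodory (A : set (borel X)) : measurable A ->
  caratheodory_measurable regular_outer (A : set X).
Proof.
move: A; apply: smallest_sub; last by move=> U; exact: open_caratheodory.
split; first exact: caratheodory_measurable_set0.
- move=> A mA; rewrite setTD; exact: caratheodory_measurable_setC.
- move=> F mF; exact: caratheodory_measurable_bigcup.
Qed.

Lemma regular_measure_sigma_additive : semi_sigma_additive regular_measure.
Proof.
move=> F mF tF mUF.
apply: (@caratheodory_measure_sigma_additive R X regular_outer) => //.
  by move=> i; exact: borel_caratheodory (mF i).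
exact: borel_caratheodory.
Qed.

HB.instance Definition _ := isMeasure.Build _ _ _ regular_measure
  regular_outer0 regular_outer_ge0 regular_measure_sigma_additive.

Lemma le_regular_measure C : closed C -> (nu C)%:E <= regular_measure C.
Proof.
by move=> cC; apply: le_ereal_inf_tmp => _ [U [oU CU] <-]; exact: le_inner_content.
Qed.

Lemma regular_measure_setT : regular_measure setT = 1.
Proof.
apply/le_anti; rewrite regular_outer_le1 /=.
by rewrite (le_trans _ (le_regular_measure (@closedT X)))// nu_setT.
Qed.

HB.instance Definition _ := Measure_isProbability.Build _ _ _ regular_measure
  regular_measure_setT.

Definition regular_probability : probability (borel X) R := regular_measure.

Lemma open_borel (U : set X) : open U -> measurable (U : set (borel X)).
Proof. by move=> oU; apply: sub_sigma_algebra. Qed.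

(** Outer regularity holds by construction, and inner regularity follows from
    it by taking complements, closed sets being compact here. *)
Lemma regular_measure_regular : regular_borel regular_probability.
Proof.
have outer A : regular_outer A =
    ereal_inf [set regular_outer U | U in [set U | open U /\ A `<=` U]].
  rewrite {1}/regular_outer; congr ereal_inf; apply/seteqP.
  by split=> _ [U [oU AU] <-]; exists U => //; rewrite regular_outer_open.
move=> A mA; split; first exact: outer.
apply/le_anti/andP; split; last first.
  apply: ge_ereal_sup => _ [C [_ CA] <-]; exact: regular_outer_mono.
apply/lee_addgt0Pr => e e0; rewrite -[leLHS]/(regular_outer A).
have [U [oU AU UE]] := regular_outer_adherent (~` A) e0.
have mU := open_borel oU.
have CA : ~` U `<=` A by rewrite -[A]setCK; exact: subsetC.
have cU : closed (~` U) by exact: open_closedC.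
apply: (@le_trans _ _ (regular_outer (~` U) + e%:E)); last first.
  rewrite leeD2r//; apply: ereal_sup_ubound; exists (~` U) => //.
  by split=> //; exact: (subclosed_compact cU Xc).
move: UE; rewrite -regular_outer_open//.
have PC (B : set (borel X)) : measurable B ->
    regular_outer (~` B) = 1 - regular_outer B.
  by move=> mB; exact: (@probability_setC _ _ _ regular_probability B mB).
rewrite !PC// -(fineK (regular_outer_fin A)) -(fineK (regular_outer_fin U)).
rewrite -!EFinB -!EFinD !lee_fin; lra.
Qed.

End regularization.

(** * Measures dominating a mean *)

Section layer_sum.
Context {R : realType}.

(** The layer sum counts, with weight [e], the positive multiples of [e]
    that do not exceed [y]: it approximates [y >= 0] from below within [e]. *)
Lemma layer_sum_full (e y : R) n : 0 < e -> n%:R * e <= y ->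
  \sum_(i < n) e * (i.+1%:R * e <= y)%R%:R = n%:R * e.
Proof.
move=> e0 ny; rewrite (eq_bigr (fun=> e)) => [|i _].
  by rewrite sumr_const card_ord mulr_natl.
have -> : i.+1%:R * e <= y.
  by apply: le_trans ny; rewrite ler_pM2r// ler_nat.
by rewrite mulr1.
Qed.

Lemma layer_sum_le (e y : R) n : 0 < e -> 0 <= y ->
  \sum_(i < n) e * (i.+1%:R * e <= y)%R%:R <= y.
Proof.
move=> e0 y0; elim: n => [|n IH]; first by rewrite big_ord0.
have [ny|ny] := leP (n.+1%:R * e) y; first by rewrite layer_sum_full.
by rewrite big_ord_recr /= (lt_geF ny) mulr0 addr0.
Qed.

Lemma layer_sum_ge (e y : R) n : 0 < e -> y <= n%:R * e ->
  y <= \sum_(i < n) e * (i.+1%:R * e <= y)%R%:R + e.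
Proof.
move=> e0; elim: n => [|n IH] yn.
  by rewrite big_ord0 add0r (le_trans yn)// mul0r ltW.
have [ny|/ltW ny] := leP y (n%:R * e).
  rewrite (le_trans (IH ny))// lerD2r big_ord_recr /= lerDl.
  by rewrite mulr_ge0 ?ler0n// ltW.
rewrite big_ord_recr /= layer_sum_full// (le_trans yn)//.
rewrite -addrA addrC -natr1 mulrDl mul1r addrC lerD2l lerDr.
by rewrite mulr_ge0 ?ler0n// ltW.
Qed.

End layer_sum.

Section mean_measure.
Context {R : realType} {X : ptopologicalType}.
Variable L : (X -> R) -> R.
Hypothesis mL : mean L.
Implicit Types (f g : X -> R) (A B : set X).

Lemma mean_le f g : f \in bounded_fun -> g \in bounded_fun ->
  (forall x, f x <= g x) -> L f <= L g.
Proof.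
move=> fb gb fg; have [LD LZ Lle] := mL.
have gN : (fun x => -1 * g x) \in bounded_fun by exact: bounded_scale.
have := Lle (f \+ (fun x => -1 * g x)) 0 (bounded_add fb gN).
rewrite LD// LZ// mulN1r subr_le0; apply => x /=.
by rewrite mulN1r subr_le0.
Qed.

Lemma mean_cst c : L (cst c) = c.
Proof.
have [_ LZ Lle] := mL; apply/le_anti/andP; split.
  exact: Lle (bounded_cst c) _.
have := Lle (fun x => -1 * cst c x) (- c) (bounded_scale (-1) (bounded_cst c)).
by rewrite LZ ?bounded_cst// mulN1r lerN2; apply => x; rewrite mulN1r.
Qed.

Lemma mean_sum (n : nat) (F : nat -> X -> R) : (forall i, F i \in bounded_fun) ->
  (fun x => \sum_(i < n) F i x) \in bounded_fun /\
  L (fun x => \sum_(i < n) F i x) = \sum_(i < n) L (F i).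
Proof.
move=> Fb; elim: n => [|n [IHb IH]].
  have -> : (fun x => \sum_(i < 0) F i x) = cst 0.
    by apply/funext => x; rewrite big_ord0.
  by rewrite big_ord0 mean_cst; split=> //; exact: bounded_cst.
have -> : (fun x => \sum_(i < n.+1) F i x) = (fun x => \sum_(i < n) F i x) \+ F n.
  by apply/funext => x; rewrite big_ord_recr.
by have [LD _ _] := mL; rewrite big_ord_recr /= -IH LD//; split=> //; exact: bounded_add.
Qed.

(** On closed sets [mu] is at least the mean of the indicator, hence the
    integral of a layer sum of [f] is at least its mean, since the superlevel
    sets of [f] are closed; and layer sums approximate [f] uniformly from
    below. *)
Theorem mean_regular_probability : hausdorff_space X -> compact [set: X] ->
  exists mu : probability (borel X) R, regular_borel mu /\
    forall f, (forall t, closed [set x | t <= f x]) -> f \in bounded_fun ->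
      (forall x, 0 <= f x) ->
      ((L f)%:E <= \int[mu]_x (f x)%:E)%E.
Proof.
move=> Xh Xc; have [LD LZ _] := mL.
pose nu A := L (\1_A).
have nuT : nu setT = 1.
  by rewrite /nu -[RHS]mean_cst; congr L; apply/funext => x; rewrite indicT.
have nu0 : nu set0 = 0.
  by rewrite /nu -[RHS]mean_cst; congr L; apply/funext => x; rewrite indic0.
have nu_mono A B : A `<=` B -> nu A <= nu B.
  move=> AB; apply: mean_le; [exact: bounded_indic|exact: bounded_indic|move=> x].
  rewrite !indicE ler_nat; case: (asboolP (x \in A)) => [xA|/negP/negbTE -> //].
  by rewrite (mem_set (AB _ (set_mem xA))) leq_b1.
have nuU A B : A `&` B = set0 -> nu (A `|` B) = nu A + nu B.
  move=> AB; rewrite /nu -LD ?bounded_indic//; congr L; apply/funext => x /=.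
  rewrite !indicE in_setU; have := congr1 (fun S : set X => x \in S) AB.
  by rewrite in_setI in_set0; case: (x \in A) => /= [->|_]; rewrite ?addr0 ?add0r.
exists (regular_probability Xh Xc nuT nu0 nu_mono nuU).
split; first exact: regular_measure_regular.
set mu := regular_probability _ _ _ _ _ _.
move=> f fc fb f0; have /asboolP[M fM] := fb.
apply/lee_addgt0Pr => e e0.
(* enough layers of height e to reach the bound M of f *)
have [n Mn] : exists n : nat, M <= n%:R * e.
  exists (Num.truncn (M / e)).+1; rewrite -ler_pdivrMr//.
  by apply/ltW; exact: truncnS_gt.
pose C (i : nat) : set X := [set x | i.+1%:R * e <= f x].
have CE i x : \1_(C i) x = (i.+1%:R * e <= f x)%R%:R :> R.
  rewrite indicE; congr (_%:R); congr nat_of_bool; apply/idP/idP.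
    by move=> /set_mem.
  by move=> h; apply/mem_set.
have mc t : measurable ([set x | t <= f x] : set (borel X)).
  rewrite -[[set x | _]]setCK; apply: measurableC; apply: open_borel.
  exact/closed_openC/fc.
have Cb i : (fun x => e * \1_(C i) x) \in bounded_fun.
  exact/bounded_scale/bounded_indic.
have [gb LgE] := mean_sum n Cb.
pose g x := \sum_(i < n) e * \1_(C i) x.
have gE x : g x = \sum_(i < n) e * (i.+1%:R * e <= f x)%R%:R.
  by apply: eq_bigr => i _; rewrite CE.
have gf x : g x <= f x by rewrite gE layer_sum_le.
have fg x : f x <= g x + e.
  rewrite gE layer_sum_ge// (le_trans _ Mn)//.
  by rewrite (le_trans _ (fM x))// ler_norm.
have Lf : L f <= L g + e.
  rewrite -[X in _ + X](mean_cst e) -LD ?bounded_cst//.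
  by apply: mean_le => //; apply: bounded_add => //; exact: bounded_cst.
apply: (@le_trans _ _ ((L g)%:E + e%:E)%E); first by rewrite -EFinD lee_fin.
rewrite leeD2r//.
have mf : measurable_fun [set: borel X] (f : borel X -> R).
  apply: (measurability _ (@RGenCInfty.measurableE R)) => _ [_ [t ->] <-].
  rewrite setTI [X in measurable X](_ : _ = [set x | t <= f x])//.
  by apply/seteqP; split=> x /=; rewrite in_itv /= andbT.
apply: (@le_trans _ _ (\int[mu]_x (g x)%:E)%E); last first.
  apply: ge0_le_integral => //.
  - by move=> x _; rewrite lee_fin sumr_ge0// => i _; rewrite mulr_ge0 ?indicE// ltW.
  - apply/measurable_EFinP; apply: measurable_sum => i.
    by apply: measurable_funM => //; apply: measurable_indic; exact: mc.
  - exact/measurable_EFinP.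
  - by move=> x _; rewrite lee_fin.
have -> : (\int[mu]_x (g x)%:E = \sum_(i < n) e%:E * mu (C i))%E.
  under eq_integral do rewrite -sumEFin.
  rewrite ge0_integral_sum//.
  - apply: eq_bigr => i _; under eq_integral do rewrite EFinM.
    rewrite ge0_integralZl_EFin ?ltW// ?integral_indic ?setIT//; first exact: mc.
    by apply/measurable_EFinP/measurable_indic; exact: mc.
  - move=> i; apply/measurable_EFinP/measurable_funM => //.
    by apply: measurable_indic; exact: mc.
  - by move=> i x _; rewrite lee_fin mulr_ge0 ?indicE// ltW.
rewrite LgE -sumEFin; apply: lee_sum => i _.
rewrite LZ ?bounded_indic// EFinM lee_pmul2l//.
by apply: le_regular_measure; exact: fc.
Qed.

End mean_measure.

(** * Polarization *)

Section multilinear_expansion.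
Context {K : numFieldType} {V W : lmodType K}.

(** Prepends a vector to an [n]-tuple, to argue by induction on the number of
    slots. *)
Definition vcons n (v : V) (x : 'I_n -> V) (i : 'I_n.+1) : V :=
  oapp x v (unlift ord0 i).

Lemma vcons_eta n (x : 'I_n.+1 -> V) : x = vcons (x ord0) (fun i => x (lift ord0 i)).
Proof. by apply/funext => i; rewrite /vcons; case: unliftP => [j|] ->. Qed.

Lemma vcons_dfwith n v (x : 'I_n -> V) i u :
  vcons v (dfwith x i u) = dfwith (vcons v x) (lift ord0 i) u.
Proof.
apply/funext => j; rewrite /vcons; case: unliftP => [l|] ->.
  have [->|li] := eqVneq l i; first by rewrite /= !dfwithin.
  rewrite /= !dfwithout ?liftK 1?eq_sym ?(inj_eq lift_inj)//.
by rewrite /= dfwithout ?unlift_none// eq_sym neq_lift.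
Qed.

Lemma vcons_dfwith0 n v w (x : 'I_n -> V) :
  vcons v x = dfwith (vcons w x) ord0 v.
Proof.
apply/funext => j; rewrite /vcons; case: unliftP => [l|] ->.
  by rewrite /= dfwithout ?liftK// neq_lift.
by rewrite dfwithin.
Qed.

Lemma multilinear_vcons n (A : ('I_n.+1 -> V) -> W) v :
  multilinear A -> multilinear (fun x : 'I_n -> V => A (vcons v x)).
Proof. by move=> mA i x a y z; rewrite !vcons_dfwith mA. Qed.

Lemma multilinear_vcons0 n (A : ('I_n.+1 -> V) -> W) (x : 'I_n -> V) :
  multilinear A -> linear (fun v : V => A (vcons v x)).
Proof.
move=> mA a y z; rewrite (vcons_dfwith0 (a *: y + z) 0) mA.
by rewrite -(vcons_dfwith0 y) -(vcons_dfwith0 z).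
Qed.

Lemma multilinear_expand n (J : finType) (A : ('I_n -> V) -> W)
    (c : 'I_n -> J -> K) (y : 'I_n -> J -> V) : multilinear A ->
  A (fun i => \sum_j c i j *: y i j) =
  \sum_(f : {ffun 'I_n -> J}) (\prod_i c i (f i)) *: A (fun i => y i (f i)).
Proof.
elim: n A c y => [|n IH] A c y mA.
  have f0 : {ffun 'I_0 -> J} := ffun0 (card_ord 0).
  rewrite (big_pred1 f0); last by move=> f; apply/esym/eqP/ffunP => -[].
  by rewrite big_ord0 scale1r; congr A; apply/funext => -[].
rewrite (vcons_eta (fun i => \sum_j c i j *: y i j)) /=.
have lA x := multilinear_vcons0 x mA.
pose L x : {linear V -> W} := HB.pack (fun v : V => A (vcons v x))
  (GRing.isLinear.Build _ _ _ _ _ (lA x)).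
rewrite -[LHS]/(L _ _) linear_sum /=.
pose h (jf : J * {ffun 'I_n -> J}) : {ffun 'I_n.+1 -> J} :=
  [ffun i => oapp jf.2 jf.1 (unlift ord0 i)].
pose h' (g : {ffun 'I_n.+1 -> J}) : J * {ffun 'I_n -> J} :=
  (g ord0, [ffun i => g (lift ord0 i)]).
rewrite (reindex h) /=; last first.
  exists h' => [[j f] _|g _].
    congr pair; first by rewrite ffunE unlift_none.
    by apply/ffunP => i; rewrite !ffunE liftK.
  by apply/ffunP => i; rewrite !ffunE; case: unliftP => [j|] -> //=; rewrite ffunE.
rewrite -(pair_bigA _ (fun j f =>
  (\prod_i c i (h (j, f) i)) *: A (fun i => y i (h (j, f) i)))) /=.
apply: eq_bigr => j _; rewrite -[LHS]/(L _ _) linearZ /=.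
have /= -> := IH _ (fun i => c (lift ord0 i)) (fun i => y (lift ord0 i))
  (multilinear_vcons (y ord0 j) mA).
rewrite scaler_sumr; apply: eq_bigr => f _; rewrite scalerA big_ord_recl.
rewrite ffunE unlift_none /=; congr (_ * _ *: A _).
  by apply: eq_bigr => i _; rewrite ffunE liftK.
apply/funext => i; rewrite ffunE /vcons; case: unliftP => [l|] -> //=.
Qed.

Lemma multilinearZ n (A : ('I_n -> V) -> W) (c : 'I_n -> K) (x : 'I_n -> V) :
  multilinear A -> A (fun i => c i *: x i) = (\prod_i c i) *: A x.
Proof.
move=> mA; have := multilinear_expand (fun i (_ : 'I_1) => c i) (fun i _ => x i) mA.
under eq_fun do rewrite big_ord1; move=> ->.
rewrite (big_pred1 [ffun=> ord0])// => f; apply/esym/eqP/ffunP => i.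
by rewrite ord1 ffunE.
Qed.

End multilinear_expansion.

Section polarization.
Context {K : numFieldType} {V W : lmodType K} {n : nat}.
Variable A : ('I_n -> V) -> W.
Hypothesis mA : multilinear A.

(** [n!] times the symmetrization of [A]: a sum over permutations, kept as
    injective self-maps of the index set. *)
Definition symmetrize (x : 'I_n -> V) : W :=
  \sum_(f : {ffun 'I_n -> 'I_n} | injectiveb f) A (fun i => x (f i)).

Lemma multilinear_symmetrize : multilinear symmetrize.
Proof.
move=> i x a u v; rewrite /symmetrize scaler_sumr -big_split /=.
apply: eq_bigr => f /injectiveP finj.
have fE w : (fun j => dfwith x i w (f j)) =
    dfwith (fun j => x (f j)) (invF finj i) w.
  apply/funext => j; have [->|ji] := eqVneq j (invF finj i).
    by rewrite dfwithin f_invF dfwithin.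
  rewrite !dfwithout// 1?eq_sym//; apply: contraNneq ji => <-.
  by rewrite invF_f.
by rewrite !fE mA.
Qed.

Lemma symmetrize_diag (x : V) : symmetrize (fun=> x) = A (fun=> x) *+ n`!.
Proof.
rewrite /symmetrize sumr_const; congr (_ *+ _).
by have := @card_inj_ffuns 'I_n 'I_n; rewrite card_ord ffactnn cardsE.
Qed.

(** Expanding every [A] on the right by multilinearity, the coefficient of
    [A (x o f)] is a product over [j] of sums over the two values of [e j]. The
    factor of [j] is [1] when [j] is a value of [f], since the term with [e j]
    false then vanishes, and [1 - 1 = 0] otherwise. Only surjective [f]
    survive, that is, the permutations. *)
Lemma polarization_identity (x : 'I_n -> V) : symmetrize x =
  \sum_(e : {ffun 'I_n -> bool}) (\prod_j (- 1) ^+ (~~ e j)) *: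
     A (fun=> \sum_j (e j)%:R *: x j).
Proof.
pose s (b : bool) : K := (- 1) ^+ (~~ b).
have E (e : {ffun 'I_n -> bool}) : A (fun=> \sum_j (e j)%:R *: x j) =
   \sum_(f : {ffun 'I_n -> 'I_n}) (\prod_i (e (f i))%:R) *: A (fun i => x (f i)).
  exact: (multilinear_expand (fun _ j => (e j)%:R) (fun _ j => x j) mA).
under eq_bigr do rewrite E scaler_sumr.
rewrite exchange_big /= /symmetrize [LHS]big_mkcond /=.
apply: eq_bigr => f _; under eq_bigr do rewrite scalerA.
rewrite -scaler_suml.
suff -> : \sum_(e : {ffun 'I_n -> bool}) (\prod_j s (e j)) * (\prod_i (e (f i))%:R)
    = (injectiveb f)%:R :> K.
  by case: ifP; rewrite ?scale1r ?scale0r.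
transitivity (\sum_(e : {ffun 'I_n -> bool})
    \prod_j (s (e j) * \prod_(i | f i == j) (e j)%:R)).
  apply: eq_bigr => e _; rewrite big_split /=; congr (_ * _).
  rewrite (partition_big f xpredT)//=; apply: eq_bigr => j _.
  by apply: eq_bigr => i /eqP ->.
rewrite -(bigA_distr_bigA (fun j b => s b * \prod_(i | f i == j) b%:R)) /=.
have FE j : \sum_(b : bool) s b * \prod_(i | f i == j) b%:R = (j \in codom f)%:R :> K.
  rewrite big_bool /= /s /= expr0 expr1 !mul1r mulN1r big1; last by [].
  have [/codomP[i ->]|jf] := boolP (j \in codom f).
    by rewrite (bigD1 i)//= mul0r subr0.
  rewrite big_pred0 ?subrr// => i; apply: contraNF jf => /eqP <-.
  exact: codom_f.
under eq_bigr do rewrite FE.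
have [finj|] := boolP (injectiveb f).
  rewrite big1// => j _; rewrite -(f_invF (injectiveP _ finj) j).
  by rewrite codom_f.
move=> fninj; have /existsP[j jf] : [exists j, j \notin codom f].
  rewrite -negb_forall; apply: contra fninj => /forallP fs.
  suff /image_injP fin : #|[seq f i | i in 'I_n]| == #|'I_n|.
    by apply/injectiveP => x1 x2; exact: fin.
  by apply/eqP/eq_card => j; rewrite -[RHS]/true -(fs j).
by rewrite (bigD1 j)//= (negbTE jf) mul0r.
Qed.

End polarization.

Section polarization_bound.
Context {R : realType} {k : scalar_kind}.
Local Notation K := (scalars R k).
Context {E : lmodType K} {G F : normedModType K} (J : {linear E -> G}) {n : nat}.

Lemma rnorm_scale_of_real (r : R) (x : G) : 0 <= r ->
  rnorm ((of_real r : K) *: x) = r * rnorm x.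
Proof. by move=> r0; rewrite rnormZ rnorm_of_real ger0_norm. Qed.

Lemma ler_rnorm_sum (V : normedModType K) (I : Type) (s : seq I) (P : pred I)
    (f : I -> V) :
  rnorm (\sum_(i <- s | P i) f i) <= \sum_(i <- s | P i) rnorm (f i).
Proof.
elim/big_ind2 : _ => [|x a y b xa yb|//]; first by rewrite rnorm0.
exact: le_trans (ler_rnormD _ _) (lerD xa yb).
Qed.

Lemma rnorm_prod (I : finType) (f : I -> K) :
  rnorm (\prod_i f i : K^o) = \prod_i rnorm (f i : K^o).
Proof.
apply: (@of_real_inj R k); rewrite of_real_rnorm normr_prod.
elim/big_ind2 : _ => [|x a y b -> ->|i _]; rewrite ?of_real1 ?of_realM//.
by rewrite of_real_rnorm.
Qed.

(** The vectors are rescaled into the unit ball of the seminorm, where the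
    polarization identity bounds the value. Stating the bound with arbitrary
    positive majorants [r] covers vectors of seminorm zero, which cannot be
    normalized. *)
Lemma symmetrize_bounded (A : ('I_n -> E) -> F) (C : R) : multilinear A -> 0 <= C ->
  (forall x, rnorm (A (fun=> x)) <= C * rnorm (J x) ^+ n) ->
  exists2 C' : R, 0 <= C' & forall (x : 'I_n -> E) (r : 'I_n -> R),
    (forall i, 0 < r i) -> (forall i, rnorm (J (x i)) <= r i) ->
    rnorm (symmetrize A x) <= C' * \prod_i r i.
Proof.
move=> mA C0 AC.
(* one term for each sign pattern; the argument has seminorm at most n *)
exists (\sum_(e : {ffun 'I_n -> bool}) C * n%:R ^+ n).
  by apply: sumr_ge0 => e _; rewrite mulr_ge0 ?exprn_ge0.
move=> x r r0 xr.
pose y i : E := (of_real (r i)^-1 : K) *: x i.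
have yx : x = (fun i => (of_real (r i) : K) *: y i).
  apply/funext => i; rewrite /y scalerA -of_realM mulfV ?gt_eqF//.
  by rewrite of_real1 scale1r.
have y1 i : rnorm (J (y i)) <= 1.
  rewrite /y linearZ rnorm_scale_of_real; last by rewrite invr_ge0 ltW.
  by rewrite ler_pdivrMl// mulr1.
rewrite yx multilinearZ; last exact: multilinear_symmetrize.
rewrite rnormZ rnorm_prod mulrC.
have -> : \prod_i rnorm (of_real (r i) : K^o) = \prod_i r i.
  by apply: eq_bigr => i _; rewrite rnorm_of_real gtr0_norm.
rewrite ler_wpM2r ?prodr_ge0//; first by move=> i _; exact: ltW.
rewrite polarization_identity// (le_trans (ler_rnorm_sum _ _ _))//.
apply: ler_sum => e _; rewrite rnormZ rnorm_prod big1 ?mul1r; last first.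
  move=> i _; apply: (@of_real_inj R k); rewrite of_real_rnorm of_real1.
  by rewrite normrX normrN normr1 expr1n.
rewrite (le_trans (AC _))// ler_wpM2l// lerXn2r ?nnegrE ?rnorm_ge0 ?ler0n//.
rewrite linear_sum (le_trans (ler_rnorm_sum _ _ _))//.
have -> : n%:R = \sum_(i < n) (1 : R) by rewrite sumr_const card_ord.
apply: ler_sum => i _.
rewrite linearZ /=; case: (e i); rewrite ?scale1r ?scale0r ?rnorm0//.
Qed.

End polarization_bound.

(** * Extension of multilinear maps to a closure *)

Section multilinear_extension.
Context {R : realType} {k : scalar_kind}.
Local Notation K := (scalars R k).
Context {E : lmodType K} {G : normedModType K} {F : completeNormedModType K}.
Context (J : {linear E -> G}) {n : nat}.
Hypothesis Jdense : forall (g : G) (e : R), 0 < e -> exists x, rnorm (g - J x) < e.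
Variables (D : ('I_n -> E) -> F) (C : R).
Hypotheses (mD : multilinear D) (C0 : 0 <= C).
Hypothesis DC : forall (x : 'I_n -> E) (r : 'I_n -> R),
  (forall i, 0 < r i) -> (forall i, rnorm (J (x i)) <= r i) ->
  rnorm (D x) <= C * \prod_i r i.

Definition approximates (g : 'I_n -> G) (d : R) (x : 'I_n -> E) :=
  forall i, rnorm (g i - J (x i)) < d.

Lemma approximates_exists g d : 0 < d -> exists x, approximates g d x.
Proof.
move=> d0; have /choice[x xP] : forall i, exists x, rnorm (g i - J x) < d.
  by move=> i; exact: Jdense.
by exists x.
Qed.

Lemma approximates_dfwith g d x i u y : approximates g d x ->
  rnorm (u - J y) < d -> approximates (dfwith g i u) d (dfwith x i y).
Proof.
move=> gx uy j; have [<-|ij] := eqVneq i j; first by rewrite !dfwithin.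
by rewrite !dfwithout.
Qed.

Lemma approximates_le g d d' x : d <= d' -> approximates g d x -> approximates g d' x.
Proof. by move=> dd' gx i; exact: lt_le_trans (gx i) dd'. Qed.

Lemma multilinear_slotB (z : 'I_n -> E) i u v :
  D (dfwith z i u) - D (dfwith z i v) = D (dfwith z i (u - v)).
Proof. by rewrite [u - v]addrC -scaleN1r mD scaleN1r addrC. Qed.

(** Replace the coordinates one at a time: each step changes [D] by its value
    at a tuple having [y i - x i] in slot [i]. *)
Lemma telescope_slots (x y : 'I_n -> E) (M d : R) : 1 <= M -> 0 < d ->
  (forall i, rnorm (J (x i)) <= M) -> (forall i, rnorm (J (y i)) <= M) ->
  (forall i, rnorm (J (y i - x i)) <= d) ->
  rnorm (D y - D x) <= n%:R * (C * (d * M ^+ n)).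
Proof.
move=> M1 d0 xM yM xyd.
have M0 : 0 < M by exact: lt_le_trans M1.
(* z m has its first m coordinates from y and the others from x *)
pose z m (i : 'I_n) := if (i < m)%N then y i else x i.
have -> : D y - D x = \sum_(0 <= m < n) (D (z m.+1) - D (z m)).
  rewrite telescope_sumr//; congr (D _ - D _); apply/funext => i.
  by rewrite /z ltn_ord.
rewrite big_mkord (le_trans (ler_rnorm_sum _ _ _))//.
rewrite mulr_natl -[n in leRHS]card_ord -sumr_const; apply: ler_sum => i _.
have zS : z i.+1 = dfwith (z i) i (y i).
  apply/funext => j; have [->|ji] := eqVneq j i.
    by rewrite dfwithin /z ltnSn.
  rewrite dfwithout 1?eq_sym// /z ltnS leq_eqVlt.
  by rewrite (inj_eq val_inj) (negbTE ji).
have zi : z i = dfwith (z i) i (x i).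
  apply/funext => j; have [->|ji] := eqVneq j i.
    by rewrite dfwithin /z ltnn.
  by rewrite dfwithout 1?eq_sym.
rewrite zS [X in _ - D X]zi multilinear_slotB.
pose r : 'I_n -> R := dfwith (fun=> M) i d.
have r0 j : 0 < r j.
  by rewrite /r; have [->|ij] := eqVneq j i; rewrite ?dfwithin// dfwithout// eq_sym.
apply: le_trans (DC r0 _) _.
  move=> j; rewrite /r; have [->|ij] := eqVneq j i; first by rewrite !dfwithin.
  by rewrite !dfwithout 1?eq_sym// /z; case: ifP.
rewrite ler_wpM2l// (bigD1 i)//= {1}/r dfwithin.
apply: ler_wpM2l; first exact: ltW.
rewrite (eq_bigr (fun=> M)); last by move=> j ij; rewrite /r dfwithout// eq_sym.
rewrite prodr_const ler_weXn2l// (leq_trans (max_card _))// card_ord.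
Qed.

Lemma approximates_cauchy g e : 0 < e -> exists2 d, 0 < d &
  forall x y, approximates g d x -> approximates g d y -> rnorm (D y - D x) < e.
Proof.
move=> e0; pose M := 1 + \sum_i rnorm (g i).
have M1 : 1 <= M by rewrite lerDl sumr_ge0// => i _; exact: rnorm_ge0.
have M0 : 0 <= M by exact: le_trans M1.
(* telescope_slots with distance 2 d gives the bound B * d *)
pose B := n%:R * (C * (2 * M ^+ n)).
have B0 : 0 <= B by rewrite !mulr_ge0// exprn_ge0.
pose d := Num.min 1 (e / (B + 1)).
have B1 : 0 < B + 1 by rewrite ltr_wpDl.
have d0 : 0 < d by rewrite lt_min ltr01 divr_gt0.
exists d => // x y gx gy.
have near_bound z : approximates g d z -> forall i, rnorm (J (z i)) <= M.
  move=> gz i; rewrite -[J (z i)](subKr (g i)) (le_trans (ler_rnormD _ _))//.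
  rewrite rnormN addrC lerD//.
    by rewrite (le_trans (ltW (gz i)))// ge_min lexx.
  by rewrite (bigD1 i)//= lerDl sumr_ge0// => j _; exact: rnorm_ge0.
apply: le_lt_trans (@telescope_slots x y M (2 * d) M1 _ _ _ _) _.
- by rewrite mulr_gt0.
- exact: near_bound.
- exact: near_bound.
- move=> i; have -> : J (y i - x i) = (g i - J (x i)) - (g i - J (y i)).
    by rewrite linearB opprB [RHS]addrC addrA subrK.
  rewrite (le_trans (ler_rnormD _ _))// rnormN mulr2n mulrDl mul1r.
  by rewrite lerD// ltW.
have -> : n%:R * (C * (2 * d * M ^+ n)) = B * d by rewrite /B; ring.
apply: (@le_lt_trans _ _ (B * (e / (B + 1)))).
  by rewrite ler_wpM2l// ge_min lexx orbT.
by rewrite mulrCA gtr_pMr// ltr_pdivrMr// mul1r ltrDl.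
Qed.

(** The images under [D] of the sets of approximating tuples generate a Cauchy
    filter. *)
Lemma approximates_cvg g : exists l : F, forall e, 0 < e -> exists2 d, 0 < d &
  forall x, approximates g d x -> rnorm (l - D x) < e.
Proof.
pose Phi : set_system F :=
  filter_from [set d : R | 0 < d] (fun d => D @` [set x | approximates g d x]).
have PhiF : ProperFilter Phi.
  apply: filter_from_proper; last first.
    by move=> d d0; have [x gx] := approximates_exists g d0; exists (D x), x.
  apply: filter_from_filter; first by exists 1 => /=.
  move=> d d' /= d0 d'0; exists (Num.min d d'); first by rewrite /= lt_min d0.
  move=> _ [x gx <-]; split; exists x => //; apply: approximates_le gx.
    by rewrite ge_min lexx.
  by rewrite ge_min lexx orbT.
have pos (e : K) : 0 < e -> of_real (scalar_Re e) = e /\ 0 < scalar_Re e.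
  move=> e0; have eE : of_real (scalar_Re e) = e.
    by rewrite -[e]gtr0_norm// of_real_scalar_Re_norm.
  by split=> //; rewrite -(ltr_of_real (k := k)) eE of_real0.
have ball_rnorm (u v : F) (e : R) : ball u (of_real e : K) v <-> rnorm (u - v) < e.
  by rewrite -ball_normE /= -of_real_rnorm ltr_of_real.
have Phic : cauchy Phi.
  apply/cauchy_exP => e /pos[eE e0].
  have [d d0 dP] := approximates_cauchy g e0.
  have [x gx] := approximates_exists g d0.
  exists (D x), d => // _ [y gy <-]; rewrite -eE; apply/ball_rnorm; exact: dP.
have Phil : Phi --> lim Phi := cauchy_cvg _ Phic; exists (lim Phi) => e e0.
have e20 : 0 < e / 2 by rewrite divr_gt0.
have [d d0 dP] := approximates_cauchy g e20; exists d => // x gx.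
have : nbhs (lim Phi) (ball (lim Phi) (of_real (e / 2) : K)).
  by apply: nbhsx_ballx; rewrite -(@of_real0 R k) ltr_of_real.
move=> /Phil[d' d'0 /= d'P].
have [|y gy] := @approximates_exists g (Num.min d d'); first by rewrite lt_min d0.
have ly : rnorm (lim Phi - D y) < e / 2.
  apply/ball_rnorm; apply: d'P; exists y => //; apply: approximates_le gy.
  by rewrite ge_min lexx orbT.
have yx : rnorm (D y - D x) < e / 2.
  by apply: dP => //; apply: approximates_le gy; rewrite ge_min lexx.
rewrite -[X in rnorm X](subrKA (D y)) (le_lt_trans (ler_rnormD _ _))//.
by rewrite [e]splitr ltrD.
Qed.

(** The extension is characterized by approximation rather than by a choice of
    sequences, so multilinearity passes to the limit by approximating all the
    arguments at once. *)
Theorem multilinear_extension : exists D' : ('I_n -> G) -> F, multilinear D' /\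
  forall g e, 0 < e -> exists2 d, 0 < d &
    forall x, approximates g d x -> rnorm (D' g - D x) < e.
Proof.
have /choice[D' D'P] := approximates_cvg; exists D'; split=> //.
move=> i g a u v; apply/eqP; rewrite -subr_eq0; apply/eqP/rnorm_eq0.
apply/le_anti; rewrite rnorm_ge0 andbT; apply/ler_addgt0Pr => e e0; rewrite add0r.
pose c := rnorm (a : K^o); have c0 : 0 <= c := rnorm_ge0 _.
have c2 : 0 < c + 2 by rewrite ltr_wpDl.
have c1 : 0 < c + 1 by rewrite ltr_wpDl.
pose e' := e / (c + 2); have e'0 : 0 < e' by rewrite divr_gt0.
have [d1 d10 P1] := D'P (dfwith g i (a *: u + v)) _ e'0.
have [d2 d20 P2] := D'P (dfwith g i u) _ e'0.
have [d3 d30 P3] := D'P (dfwith g i v) _ e'0.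
pose d0 := Num.min d1 (Num.min d2 d3).
have d00 : 0 < d0 by rewrite !lt_min d10 d20.
have [d01 d02 d03] : [/\ d0 <= d1, d0 <= d2 & d0 <= d3].
  by rewrite /d0 !ge_min !lexx !orbT.
pose d := d0 / (c + 1).
have dpos : 0 < d by rewrite divr_gt0.
have dd0 : d <= d0 by rewrite ler_pdivrMr// ler_peMr ?(ltW d00)// lerDr.
have [x gx] := @approximates_exists g d dpos.
have [y uy] := Jdense u dpos; have [z vz] := Jdense v dpos.
have uvyz : rnorm (a *: u + v - J (a *: y + z)) < d0.
  have -> : a *: u + v - J (a *: y + z) = a *: (u - J y) + (v - J z).
    by rewrite linearP scalerBr opprD addrACA.
  rewrite (le_lt_trans (ler_rnormD _ _))// rnormZ -/c.
  have -> : d0 = c * d + d by rewrite /d; field; rewrite gt_eqF.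
  by rewrite ler_ltD// ler_wpM2l// ltW.
have gx0 := approximates_le dd0 gx.
have A1 := P1 _ (approximates_le d01 (approximates_dfwith i gx0 uvyz)).
have A2 := P2 _ (approximates_le d02 (approximates_dfwith i gx0 (lt_le_trans uy dd0))).
have A3 := P3 _ (approximates_le d03 (approximates_dfwith i gx0 (lt_le_trans vz dd0))).
rewrite mD in A1.
set l1 := D' _ in A1 *; set l2 := D' _ in A2 *; set l3 := D' _ in A3 *.
set w2 := D _ in A1 A2; set w3 := D _ in A1 A3.
have -> : l1 - (a *: l2 + l3) =
    (l1 - (a *: w2 + w3)) - (a *: (l2 - w2) + (l3 - w3)).
  by rewrite scalerBr addrACA -opprD opprB addrA subrK.
rewrite (le_trans (ler_rnormD _ _))// rnormN.
have : rnorm (a *: (l2 - w2) + (l3 - w3)) <= c * e' + e'.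
  by rewrite (le_trans (ler_rnormD _ _))// rnormZ lerD ?ler_wpM2l// ltW.
have -> : e = e' + (c * e' + e') by rewrite /e'; field; rewrite gt_eqF.
by move=> h; rewrite lerD// ltW.
Qed.

End multilinear_extension.

(** * The Pietsch measure of a dominated polynomial *)

Section dual_ball_topology.
Context {R : realType} {k : scalar_kind} {E : normedModType (scalars R k)}.
Local Notation K := (scalars R k).

Lemma dual_ball_hausdorff : hausdorff_space (dual_ball E).
Proof.
move=> phi psi cl; apply/val_inj/funext => x.
apply: (@norm_hausdorff K K^o) => A B /dual_ball_eval_continuous nA.
move=> /dual_ball_eval_continuous nB.
by have [chi [Ac Bc]] := cl _ _ nA nB; exists (dual_ball_fun chi x).
Qed.

Lemma dual_ball_linear (phi : dual_ball E) : linear phi.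
Proof.
have : dual_ball_set (dual_ball_fun phi) by exact: (set_mem (valP phi)).
by move=> [lphi _ _]; exact: lphi.
Qed.

Lemma dual_ballZ (phi : dual_ball E) (a : K) x : phi (a *: x) = a *: phi x.
Proof.
pose l : {linear E -> K^o} :=
  HB.pack (phi : E -> K^o) (GRing.isLinear.Build _ _ _ _ _ (dual_ball_linear phi)).
by rewrite -[LHS]/(l (a *: x)) linearZ.
Qed.

Lemma rnorm_eval_bounded (x : E) (p : R) : 0 <= p ->
  (fun phi : dual_ball E => rnorm (phi x) `^ p) \in bounded_fun.
Proof.
move=> p0; apply/asboolP; exists (rnorm x `^ p) => phi.
rewrite ger0_norm ?powR_ge0// ge0_ler_powR ?nnegrE ?rnorm_ge0//.
exact: dual_ball_le.
Qed.

(** For [t > 0] the condition [t <= |phi x|^p] reads [t^(1/p) <= |phi x|], which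
    is closed by continuity of the evaluation. *)
Lemma closed_rnorm_eval (x : E) (p t : R) : 0 < p ->
  closed [set phi : dual_ball E | t <= rnorm (phi x) `^ p].
Proof.
move=> p0; have [t0|t0] := leP t 0.
  rewrite [X in closed X](_ : _ = setT); first exact: closedT.
  by apply/seteqP; split=> // phi _ /=; rewrite (le_trans t0)// powR_ge0.
rewrite [X in closed X](_ : _ = [set phi : dual_ball E | t `^ p^-1 <= rnorm (phi x)]).
  apply: (closed_comp _ (@closed_ge R (t `^ p^-1))) => phi _.
  apply: (@continuous_comp _ _ _ (fun phi : dual_ball E => phi x) (rnorm : K^o -> R)).
    exact: dual_ball_eval_continuous.
  exact: rnorm_continuous.
apply/seteqP; split=> phi /=.
  move=> h; rewrite -[leRHS]powRr1 ?rnorm_ge0// -(mulfV (lt0r_neq0 p0)) powRrM.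
  by apply: ge0_ler_powR; rewrite ?nnegrE ?powR_ge0 ?invr_ge0// ltW.
move=> h; rewrite -[leLHS](powRr1 (ltW t0)) -(mulVf (lt0r_neq0 p0)) powRrM.
by apply: ge0_ler_powR; rewrite ?nnegrE ?powR_ge0 ?rnorm_ge0// ltW.
Qed.

End dual_ball_topology.

Section pietsch.
Context {R : realType} {k : scalar_kind} {E F : normedModType (scalars R k)}.
Local Notation K := (scalars R k).
Context (n : nat) (p : R) (P : E -> F).
Hypotheses (n_gt0 : (0 < n)%N) (p1 : 1 <= p).
Hypothesis Phom : forall (t : R) x, 0 <= t ->
  rnorm (P ((of_real t : K) *: x)) = t ^+ n * rnorm (P x).

Let p0 : 0 < p. Proof. exact: lt_le_trans p1. Qed.
Let n0 : 0 < n%:R :> R. Proof. by rewrite ltr0n. Qed.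
Let q := p / n%:R.
Let q0 : 0 < q. Proof. exact: divr_gt0. Qed.
Let q' := n%:R / p.
Let q'0 : 0 < q'. Proof. exact: divr_gt0. Qed.
Let qq' : q * q' = 1.
Proof. by rewrite /q /q'; field; rewrite !gt_eqF. Qed.

(** If the sum were at most [- e] at every [phi], then, with [A] the sum of the
    [|P y|^q] and [S] that of the [|phi y|^p], [C^q S <= A - e] everywhere.
    Raising to the power [1/q] and taking suprema contradicts the domination
    inequality, whose left side is [A^(1/q)]. *)
Lemma domination_cone_gt (C : R) (s : seq E) (e : R) : 0 <= C ->
  (forall (m : nat) (x : 'I_m -> E), (0 < m)%N ->
    (\sum_(j < m) rnorm (P (x j)) `^ (p / n%:R)) `^ (n%:R / p) <=
    C * sup [set (\sum_(j < m) rnorm (phi (x j)) `^ p) `^ (n%:R / p)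
            | phi in [set: dual_ball E]]) ->
  0 < e -> exists phi : dual_ball E,
    - e < \sum_(y <- s) (C `^ q * rnorm (phi y) `^ p - rnorm (P y) `^ q).
Proof.
move=> C0 dom e0; apply: contrapT => /forallNP nphi.
have [/size0nil s0|s_gt0] := posnP (size s).
  by apply: (nphi point); rewrite s0 big_nil oppr_lt0.
pose A := \sum_(y <- s) rnorm (P y) `^ q.
pose S (phi : dual_ball E) := \sum_(y <- s) rnorm (phi y) `^ p.
have S0 phi : 0 <= S phi by apply: sumr_ge0 => y _; exact: powR_ge0.
have SA phi : C `^ q * S phi <= A - e.
  have /negP := nphi phi; rewrite -leNgt sumrB -mulr_sumr -/A -/(S phi).
  by move=> h; rewrite lerBrDl; lra.
have Ae0 : 0 <= A - e.
  by apply: le_trans (SA point); rewrite mulr_ge0 ?powR_ge0.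
have CE : C = (C `^ q) `^ q' by rewrite -powRrM qq' powRr1.
have CSA phi : C * S phi `^ q' <= (A - e) `^ q'.
  rewrite {1}CE -powRM ?powR_ge0//.
  apply: ge0_ler_powR; rewrite ?nnegrE ?mulr_ge0 ?powR_ge0//.
  by rewrite invr_ge0 ltW.
have /= := dom (size s) (fun i => tnth (in_tuple s) i) s_gt0.
rewrite -(big_tnth _ _ _ xpredT (fun y => rnorm (P y) `^ (p / n%:R))) -/q -/q' -/A.
set T := [set _ | _ in _] => AT.
have TE : T = [set S phi `^ q' | phi in setT].
  apply: eq_imagel => phi _.
  by rewrite -(big_tnth _ _ _ xpredT (fun y => rnorm (phi y) `^ p)).
have : C * sup T <= (A - e) `^ q'.
  move: C0; rewrite le_eqVlt => /orP[/eqP <-|Cpos]; first by rewrite mul0r powR_ge0.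
  rewrite mulrC -ler_pdivlMr// TE; apply: ge_sup.
    by exists (S point `^ q'), point.
  by move=> _ [phi _ <-]; rewrite ler_pdivlMr// mulrC.
move=> /(le_trans AT); apply/negP; rewrite -ltNge.
by rewrite gt0_ltr_powR ?nnegrE//; lra.
Qed.

(** Each generator of the cone has a nonnegative mean, that is, [|P x|^q] is at
    most [C^q] times the mean of [|phi x|^p], which the integral dominates. The
    cone is stable under multiplication by [a > 0] because replacing [x] by
    [a^(1/p) x] multiplies both terms of a generator by [a]. *)
Lemma pietsch_domination (C : R) : 0 <= C ->
  (forall (m : nat) (x : 'I_m -> E), (0 < m)%N ->
    (\sum_(j < m) rnorm (P (x j)) `^ (p / n%:R)) `^ (n%:R / p) <=
    C * sup [set (\sum_(j < m) rnorm (phi (x j)) `^ p) `^ (n%:R / p)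
            | phi in [set: dual_ball E]]) ->
  exists2 mu : probability (borel (dual_ball E)) R, regular_borel mu &
    forall x, ((rnorm (P x) `^ q)%:E <=
      (C `^ q)%:E * \int[mu]_phi (rnorm ((phi : dual_ball E) x) `^ p)%:E)%E.
Proof.
move=> C0 dom.
pose gam (x : E) (phi : dual_ball E) := C `^ q * rnorm (phi x) `^ p - rnorm (P x) `^ q.
pose Gam := [set g | exists s, g = (fun phi => \sum_(y <- s) gam y phi)].
have gamb x : gam x \in bounded_fun.
  apply: (bounded_add (bounded_scale _ (rnorm_eval_bounded x (ltW p0)))).
  exact: bounded_cst.
have [|||||L [mL LG]] := @mean_of_cone R (dual_ball E) Gam.
- move=> _ [s ->]; elim: s => [|y s IH].
    rewrite (_ : (fun _ => _) = cst 0); first exact: bounded_cst.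
    by apply/funext => phi; rewrite big_nil.
  rewrite (_ : (fun _ => _) = gam y \+ (fun phi => \sum_(y <- s) gam y phi)).
    exact: bounded_add.
  by apply/funext => phi; rewrite big_cons.
- by exists [::]; apply/funext => phi; rewrite big_nil.
- move=> _ _ [s ->] [t ->]; exists (s ++ t); apply/funext => phi.
  by rewrite big_cat.
- move=> a _ a0 [s ->]; exists [seq (of_real (a `^ p^-1) : K) *: y | y <- s].
  apply/funext => phi; rewrite big_map mulr_sumr; apply: eq_bigr => y _.
  rewrite /gam Phom ?powR_ge0// -powR_mulrn ?powR_ge0// -powRrM.
  rewrite powRM ?powR_ge0 ?rnorm_ge0// -powRrM.
  have -> : p^-1 * n%:R * q = 1 by rewrite /q; field; rewrite !gt_eqF.
  rewrite dual_ballZ rnormZ rnorm_of_real ger0_norm ?powR_ge0//.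
  rewrite powRM ?powR_ge0 ?rnorm_ge0//.
  by rewrite -powRrM mulVf ?gt_eqF// powRr1 ?(ltW a0)//; ring.
- by move=> _ e [s ->] e0; exact: domination_cone_gt.
have [mu [rmu Lmu]] :=
  mean_regular_probability mL dual_ball_hausdorff (@dual_ball_compact R k E).
exists mu => // x.
have fb := rnorm_eval_bounded x (ltW p0).
have [LD LZ _] := mL.
have : 0 <= L (gam x) by apply: LG; exists [:: x]; apply/funext => phi; rewrite big_seq1.
have -> : gam x = (fun phi => C `^ q * rnorm (phi x) `^ p) \+ cst (- rnorm (P x) `^ q).
  by [].
rewrite LD ?bounded_cst ?bounded_scale// LZ// mean_cst// subr_ge0.
rewrite -lee_fin => /le_trans; apply.
rewrite EFinM lee_wpmul2l ?lee_fin ?powR_ge0//; apply: Lmu => //.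
- by move=> t; exact: closed_rnorm_eval.
- by move=> phi; exact: powR_ge0.
Qed.

End pietsch.

(** * Linearization on the symmetric tensor product *)

Section tensor_linearization.
Context {R : realType} {k : scalar_kind} {n : nat}.
Local Notation K := (scalars R k).

Lemma multilinear_diagZ (V W : lmodType K) (A : ('I_n -> V) -> W) (a : K) (x : V) :
  multilinear A -> A (fun=> a *: x) = a ^+ n *: A (fun=> x).
Proof. by move=> mA; rewrite multilinearZ// prodr_const card_ord. Qed.

Lemma rnorm_diagZ (V : lmodType K) (W : normedModType K) (A : ('I_n -> V) -> W)
  (t : R) (x : V) : multilinear A -> 0 <= t ->
  rnorm (A (fun=> (of_real t : K) *: x)) = t ^+ n * rnorm (A (fun=> x)).
Proof.
move=> mA t0; rewrite multilinear_diagZ// rnormZ; congr (_ * _).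
apply: (@of_real_inj R k); rewrite of_real_rnorm normrX.
have -> : `|of_real t : K| = of_real t.
  by rewrite -(@of_real_rnorm R k K^o) rnorm_of_real ger0_norm.
elim: (n) => [|m IH]; first by rewrite !expr0 of_real1.
by rewrite !exprS of_realM IH.
Qed.

Context {G F : normedModType K}.

Lemma proj_s_norm_ge0 (theta : sym_tensor n G) : 0 <= proj_s_norm theta.
Proof.
rewrite /proj_s_norm; set S := [set s | _].
have [->|/set0P S0] := eqVneq S set0; first by rewrite inf0.
apply: lb_le_inf => // _ [m [l [x [_ ->]]]].
by apply: sumr_ge0 => i _; rewrite mulr_ge0 ?exprn_ge0 ?rnorm_ge0.
Qed.

Lemma proj_s_norm_le (theta : sym_tensor n G) m (l : 'I_m -> K) (x : 'I_m -> G) :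
  theta = \sum_(i < m) l i *: diag_tensor n (x i) ->
  proj_s_norm theta <= \sum_(i < m) rnorm (l i : K^o) * rnorm (x i) ^+ n.
Proof.
move=> thE; apply: ge_inf; last by exists m, l, x.
exists 0 => _ [m' [l' [x' [_ ->]]]].
by apply: sumr_ge0 => i _; rewrite mulr_ge0 ?exprn_ge0 ?rnorm_ge0.
Qed.

Lemma proj_s_norm0 : proj_s_norm (0 : sym_tensor n G) = 0.
Proof.
apply/le_anti; rewrite proj_s_norm_ge0 andbT.
by have := @proj_s_norm_le 0 0 (fun=> 0) (fun=> 0); rewrite !big_ord0; exact.
Qed.

Lemma proj_s_norm_diag (x : G) : proj_s_norm (diag_tensor n x) <= rnorm x ^+ n.
Proof.
have := @proj_s_norm_le (diag_tensor n x) 1 (fun=> 1) (fun=> x).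
rewrite !big_ord1 scale1r => /(_ erefl) /le_trans; apply.
by rewrite -of_real1 rnorm_of_real normr1 mul1r.
Qed.

Lemma sym_tensorE (theta : sym_tensor n G) : exists m (l : 'I_m -> K) (x : 'I_m -> G),
  theta = \sum_(i < m) l i *: diag_tensor n (x i).
Proof.
have /asboolP[m [l [x thE]]] := valP theta; exists m, l, x; apply: val_inj.
rewrite [LHS]thE linear_sum; apply: eq_bigr => i _.
by rewrite linearZ.
Qed.

Variable A : ('I_n -> G) -> F.
Hypothesis mA : multilinear A.

Lemma multilinear_functional (l : {linear F -> K^o}) :
  multilinear (fun x => l (A x) : K^o).
Proof. by move=> i x a u w; rewrite mA linearP. Qed.

Definition functional_form (l : {linear F -> K^o}) : multilinear_form n G :=
  exist _ (fun x => l (A x)) (multilinear_functional l).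

(** Any representation of [theta] as a combination of diagonal tensors provides
    the vector; its independence of the representation comes from
    [separating_functional]. *)
Lemma linearization_exists (theta : sym_tensor n G) :
  exists f : F, forall l : {linear F -> K^o}, l f = val theta (functional_form l).
Proof.
have /asboolP[m [c [x ->]]] := valP theta.
exists (\sum_(i < m) c i *: A (fun=> x i)) => l.
rewrite linear_sum fct_sumE; apply: eq_bigr => i _.
by rewrite linearZ.
Qed.

Definition linearization (theta : sym_tensor n G) : F :=
  sval (cid (linearization_exists theta)).

Lemma linearizationP theta (l : {linear F -> K^o}) :
  l (linearization theta) = val theta (functional_form l).
Proof. by rewrite /linearization; case: cid. Qed.

Lemma linearization_linear : linear linearization.
Proof.
move=> a th th'; apply/eqP; rewrite -subr_eq0; apply/eqP/separating_functional => l.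
by rewrite linearB linearP /= !linearizationP linearP subrr.
Qed.

HB.instance Definition _ := GRing.isLinear.Build K (sym_tensor n G) F _
  linearization linearization_linear.

Lemma linearization_diag (x : G) : linearization (diag_tensor n x) = A (fun=> x).
Proof.
apply/eqP; rewrite -subr_eq0; apply/eqP/separating_functional => l.
by rewrite linearB /= linearizationP subrr.
Qed.

Variable c : R.
Hypotheses (c0 : 0 <= c) (Ac : forall x, rnorm (A (fun=> x)) <= c * rnorm x ^+ n).

Lemma linearization_le theta : rnorm (linearization theta) <= c * proj_s_norm theta.
Proof.
have vle m (l : 'I_m -> K) (x : 'I_m -> G) :
    theta = \sum_(i < m) l i *: diag_tensor n (x i) ->
    rnorm (linearization theta) <= c * \sum_(i < m) rnorm (l i : K^o) * rnorm (x i) ^+ n.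
  move=> ->; rewrite linear_sum (le_trans (ler_rnorm_sum _ _ _))// mulr_sumr.
  apply: ler_sum => i _; rewrite linearZ /= linearization_diag rnormZ mulrCA.
  by rewrite ler_wpM2l ?rnorm_ge0.
have [m [l [x thE]]] := sym_tensorE theta.
move: c0; rewrite le_eqVlt => /orP[/eqP c00|cpos].
  by have := vle _ _ _ thE; rewrite -c00 !mul0r.
rewrite mulrC -ler_pdivrMr//; apply: lb_le_inf.
  by eexists; exists m, l, x; split; first exact: thE.
by move=> _ [m' [l' [x' [/vle + ->]]]]; rewrite ler_pdivrMr// mulrC.
Qed.

Lemma linearization_continuous : proj_s_continuous linearization.
Proof.
have c1 : 0 < c + 1 by rewrite ltr_wpDl.
move=> th e e0; exists (e / (c + 1)); first exact: divr_gt0.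
move=> th' h; rewrite -linearB (le_lt_trans (linearization_le _))//.
apply: (@le_lt_trans _ _ (c * (e / (c + 1)))); first by rewrite ler_wpM2l// ltW.
by rewrite mulrCA gtr_pMr// ltr_pdivrMr// mul1r ltrDl.
Qed.

Lemma opnorm_ub : has_ubound
  [set rnorm (linearization theta) | theta in [set theta | proj_s_norm theta <= 1]].
Proof.
exists c => _ [th th1 <-]; rewrite (le_trans (linearization_le _))//.
by rewrite ler_piMr.
Qed.

Lemma opnorm_le : proj_s_opnorm linearization <= c.
Proof.
apply: ge_sup; first by exists (rnorm (linearization 0)), 0 => //=; rewrite proj_s_norm0.
move=> _ [th th1 <-]; rewrite (le_trans (linearization_le _))//.
by rewrite ler_piMr.
Qed.

Lemma opnorm_ge0 : 0 <= proj_s_opnorm linearization.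
Proof.
apply: le_trans (rnorm_ge0 (linearization 0)) _.
by apply: ub_le_sup; [exact: opnorm_ub|exists 0 => //=; rewrite proj_s_norm0].
Qed.

(** Evaluate [v] at the diagonal tensor of [x / ||x||]; when [||x|| = 0] the
    assumed bound gives a zero left side. *)
Lemma opnorm_ge (x : G) : (0 < n)%N ->
  rnorm (A (fun=> x)) <= proj_s_opnorm linearization * rnorm x ^+ n.
Proof.
move=> n0; have := rnorm_ge0 x; rewrite le_eqVlt => /orP[/eqP x0|x0].
  have := Ac x; rewrite -x0 expr0n gtn_eqF// !mulr0; exact.
rewrite mulrC -ler_pdivrMl ?exprn_gt0// -exprVn.
rewrite -rnorm_diagZ//; last by rewrite invr_ge0 ltW.
rewrite /proj_s_opnorm; apply: ub_le_sup; first exact: opnorm_ub.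
rewrite -linearization_diag.
exists (diag_tensor n ((of_real (rnorm x)^-1 : K) *: x)) => //=.
rewrite (le_trans (proj_s_norm_diag _))// rnorm_scale_of_real.
  by rewrite mulVf ?gt_eqF// expr1n.
by rewrite invr_ge0 ltW.
Qed.

End tensor_linearization.

(** * Closure of the range of a linear map *)

Section range_closure.
Context {R : realType} {k : scalar_kind}.
Local Notation K := (scalars R k).
Context {E : lmodType K} {V : normedModType K} (J : {linear E -> V}).

Definition range_closure_pred : {pred V} :=
  fun g => `[< forall e : R, 0 < e -> exists x, rnorm (g - J x) < e >].

Lemma range_closure_submod : submod_closed range_closure_pred.
Proof.
split; first by apply/asboolP => e e0; exists 0; rewrite linear0 subrr rnorm0.
move=> a g h /asboolP gJ /asboolP hJ; apply/asboolP => e e0.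
pose c := rnorm (a : K^o); have c0 : 0 <= c := rnorm_ge0 _.
have c1 : 0 < c + 1 by rewrite ltr_wpDl.
have d0 : 0 < e / (c + 1) by rewrite divr_gt0.
have [x gx] := gJ _ d0; have [y hy] := hJ _ d0; exists (a *: x + y).
have -> : a *: g + h - J (a *: x + y) = a *: (g - J x) + (h - J y).
  by rewrite linearP scalerBr opprD addrACA.
rewrite (le_lt_trans (ler_rnormD _ _))// rnormZ -/c.
have -> : e = c * (e / (c + 1)) + e / (c + 1) by field; rewrite gt_eqF.
by rewrite ler_ltD// ler_wpM2l// ltW.
Qed.

Lemma range_closure_closed : closed [set g : V | g \in range_closure_pred].
Proof.
move=> g clg; apply/asboolP => e e0.
have e20 : 0 < e / 2 by rewrite divr_gt0.
have : nbhs g (ball g (of_real (e / 2) : K)).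
  by apply: nbhsx_ballx; rewrite -(@of_real0 R k) ltr_of_real.
move=> /clg[h [/asboolP hJ]]; rewrite -ball_normE /= -of_real_rnorm ltr_of_real => gh.
have [x hx] := hJ _ e20; exists x.
rewrite -(subrKA h) (le_lt_trans (ler_rnormD _ _))//.
by rewrite [e]splitr ltrD.
Qed.

Definition range_closure : closed_subspace V :=
  ClosedSubspace range_closure_submod range_closure_closed.

Lemma range_closureP x : J x \in csub_pred range_closure.
Proof. by apply/asboolP => e e0; exists x; rewrite subrr rnorm0. Qed.

Definition range_closure_map (x : E) : range_closure := csub_elt (range_closureP x).

Lemma range_closure_map_linear : linear range_closure_map.
Proof. by move=> a x y; apply: val_inj; rewrite /= linearP. Qed.

HB.instance Definition _ := GRing.isLinear.Build K E range_closure _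
  range_closure_map range_closure_map_linear.

Lemma range_closure_dense (g : range_closure) (e : R) : 0 < e ->
  exists x, rnorm (g - range_closure_map x) < e.
Proof. by move=> e0; have /asboolP/(_ e e0) := valP g. Qed.

End range_closure.

(** * Domination and bounds by the L_p norm *)

Section Lp_embedding.
Context {R : realType} {k : scalar_kind} {E : normedModType (scalars R k)}.
Local Notation K := (scalars R k).
Context (mu : probability (borel (dual_ball E)) R) (p : R) (p1 : 1 <= p).

Definition Lp_embedding (x : E) : Lp_space mu p1 :=
  Lp_inclusion mu p1 (evaluation x).

Lemma Lp_embedding_linear : linear Lp_embedding.
Proof.
move=> a x y; rewrite /Lp_embedding /Lp_inclusion.
rewrite -[a *: Lp_class _]/(Lp_scale a (Lp_class _)) Lp_scale_class -Lp_classD.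
congr Lp_class; apply: val_inj.
by apply/funext => phi /=; rewrite dual_ball_linear.
Qed.

HB.instance Definition _ := GRing.isLinear.Build K E (Lp_space mu p1) _
  Lp_embedding Lp_embedding_linear.

Lemma rnorm_Lp_embedding (x : E) :
  ((rnorm (Lp_embedding x) `^ p)%:E =
   \int[mu]_phi (rnorm ((phi : dual_ball E) x) `^ p)%:E)%E.
Proof.
have p_neq0 : p != 0 by rewrite gt_eqF// (lt_le_trans _ p1).
rewrite /rnorm of_realK -poweR_EFin Lp_norm_class /Lp_enorm powR_Lnorm//.
by apply: eq_integral => phi _; rewrite /= ger0_norm ?rnorm_ge0.
Qed.

End Lp_embedding.

Section domination.
Context {R : realType} {k : scalar_kind} {E F : normedModType (scalars R k)}.
Local Notation K := (scalars R k).
Context (n : nat) (p : R) (P : E -> F).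
Hypotheses (n_gt0 : (0 < n)%N) (p1 : 1 <= p).

Let p0 : 0 < p. Proof. exact: lt_le_trans p1. Qed.
Let n0 : 0 < n%:R :> R. Proof. by rewrite ltr0n. Qed.
Let q := p / n%:R.
Let q0 : 0 < q. Proof. exact: divr_gt0. Qed.
Let q' := n%:R / p.
Let q'0 : 0 < q'. Proof. exact: divr_gt0. Qed.
Let qq' : q * q' = 1.
Proof. by rewrite /q /q'; field; rewrite !gt_eqF. Qed.

Lemma domination_sup_ub m (x : 'I_m -> E) (phi : dual_ball E) :
  (\sum_(j < m) rnorm (phi (x j)) `^ p) `^ q' <=
  sup [set (\sum_(j < m) rnorm (phi (x j)) `^ p) `^ q' | phi in [set: dual_ball E]].
Proof.
apply: ub_le_sup; last by exists phi.
exists ((\sum_(j < m) rnorm (x j) `^ p) `^ q') => _ [psi _ <-].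
have h0 (f : 'I_m -> R) : 0 <= \sum_(j < m) f j `^ p.
  by apply: sumr_ge0 => j _; exact: powR_ge0.
apply: ge0_ler_powR; rewrite ?nnegrE ?h0 ?(ltW q'0)//.
apply: ler_sum => j _; apply: ge0_ler_powR; rewrite ?nnegrE ?rnorm_ge0 ?(ltW p0)//.
exact: dual_ball_le.
Qed.

Lemma domination_sup_ge0 m (x : 'I_m -> E) :
  0 <= sup [set (\sum_(j < m) rnorm (phi (x j)) `^ p) `^ q' | phi in [set: dual_ball E]].
Proof. exact: le_trans (powR_ge0 _ _) (domination_sup_ub x point). Qed.

Lemma dominated_norm_domination : p_dominated n p P ->
  0 <= dominated_norm n p P /\
  forall (m : nat) (x : 'I_m -> E), (0 < m)%N ->
    (\sum_(j < m) rnorm (P (x j)) `^ (p / n%:R)) `^ (n%:R / p) <=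
    dominated_norm n p P *
      sup [set (\sum_(j < m) rnorm (phi (x j)) `^ p) `^ (n%:R / p)
          | phi in [set: dual_ball E]].
Proof.
move=> [C0 C0dom]; split.
  by apply: lb_le_inf; [exists C0|move=> C [/ltW]].
move=> m x m0; have := domination_sup_ge0 x; rewrite -/q -/q'.
set S := sup _; rewrite le_eqVlt => /orP[/eqP S0|S0].
  by have [_ /(_ m x m0)] := C0dom; rewrite -/q -/q' -/S -S0 !mulr0.
rewrite -ler_pdivrMr//; apply: lb_le_inf; first by exists C0.
by move=> C [_ /(_ m x m0)]; rewrite -/q -/q' -/S ler_pdivrMr.
Qed.

(** Integrating [sum_j |phi (x_j)|^p] against a probability measure gives at
    most its supremum. *)
Lemma domination_of_bound (mu : probability (borel (dual_ball E)) R) (M : R) : 0 < M ->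
  (forall x, rnorm (P x) <= M * rnorm (Lp_embedding mu p1 x) ^+ n) ->
  domination_constant n p P M.
Proof.
move=> M0 PM; split=> // m x _; rewrite -/q -/q'.
set T := sup _.
have T0 : 0 <= T := domination_sup_ge0 x.
pose N y := rnorm (Lp_embedding mu p1 y).
have Pq y : rnorm (P y) `^ q <= M `^ q * N y `^ p.
  have -> : N y `^ p = (N y ^+ n) `^ q.
    rewrite -powR_mulrn ?rnorm_ge0// -powRrM; congr (_ `^ _).
    by rewrite /q; field; rewrite gt_eqF.
  rewrite -powRM ?exprn_ge0 ?rnorm_ge0 ?(ltW M0)//.
  apply: ge0_ler_powR; rewrite ?nnegrE ?rnorm_ge0 ?(ltW q0)//.
  by rewrite mulr_ge0 ?exprn_ge0 ?rnorm_ge0// ltW.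
have mN j : measurable_fun [set: borel (dual_ball E)]
    (fun phi : dual_ball E => (rnorm (phi (x j)) `^ p)%:E).
  apply/measurable_EFinP; apply: (measurableT_comp (measurable_powR p)).
  apply: continuous_borel_measurable => phi.
  apply: (@continuous_comp _ _ _ (fun phi : dual_ball E => phi (x j)) (rnorm : K^o -> R)).
    exact: dual_ball_eval_continuous.
  exact: rnorm_continuous.
have NT : \sum_(j < m) N (x j) `^ p <= T `^ q.
  rewrite -lee_fin -sumEFin.
  under eq_bigr do rewrite rnorm_Lp_embedding.
  rewrite -ge0_integral_sum//; last first.
    by move=> j phi _; rewrite lee_fin powR_ge0.
  apply: (@le_trans _ _ (\int[mu]_(phi in setT) (cst (T `^ q)%:E phi))%E); last first.
    by rewrite integral_cst// [X in (_ * X)%E]probability_setT mule1.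
  apply: ge0_le_integral => //.
  - by move=> phi _; apply: sume_ge0 => j _; rewrite lee_fin powR_ge0.
  - by apply: emeasurable_sum.
  - move=> phi _; rewrite sumEFin lee_fin.
    rewrite -[leLHS]powRr1; last by apply: sumr_ge0 => j _; exact: powR_ge0.
    rewrite -qq' mulrC powRrM; apply: ge0_ler_powR; rewrite ?nnegrE ?powR_ge0 ?(ltW q0)//.
    exact: domination_sup_ub.
have -> : M * T = ((M `^ q) * (T `^ q)) `^ q'.
  by rewrite powRM ?powR_ge0// -!powRrM qq' !powRr1// ltW.
apply: ge0_ler_powR; rewrite ?nnegrE ?(ltW q'0)//.
- by apply: sumr_ge0 => j _; exact: powR_ge0.
- by rewrite mulr_ge0 ?powR_ge0.
apply: (@le_trans _ _ (\sum_(j < m) M `^ q * N (x j) `^ p)).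
  by apply: ler_sum => j _; exact: Pq.
by rewrite -mulr_sumr ler_wpM2l ?powR_ge0.
Qed.

End domination.

(** * The factorization *)

Section factorization.
Context {R : realType} {k : scalar_kind} {E F : completeNormedModType (scalars R k)}.
Local Notation K := (scalars R k).
Context (n : nat) (n_gt0 : (0 < n)%N) (p : R) (p1 : 1 <= p) (P : E -> F).
Hypothesis hP : continuous_homogeneous_polynomial n P.

Lemma ler_dist_rnorm (V : normedModType K) (x y : V) :
  `|rnorm x - rnorm y| <= rnorm (x - y).
Proof.
rewrite ler_norml lerNl opprB !lerBlDr; apply/andP; split.
  by have := ler_rnormD (y - x) x; rewrite subrK -(rnormN (y - x)) opprB.
by have := ler_rnormD (x - y) y; rewrite subrK.
Qed.

Lemma homogeneous_rnorm (t : R) (x : E) : 0 <= t ->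
  rnorm (P ((of_real t : K) *: x)) = t ^+ n * rnorm (P x).
Proof. by have [_ [A [mA PA]]] := hP; rewrite !PA; exact: rnorm_diagZ. Qed.

(** Homogeneity turns a bound near [0] into a global one. When [J x = 0], all
    multiples of [x] are in the neighborhood, so [P x = 0]. *)
Lemma homogeneous_bound (V : normedModType K) (J : {linear E -> V}) (d : R) : 0 < d ->
  (forall x, rnorm (J x) ^+ n < d -> rnorm (P x) < 1) ->
  forall x, rnorm (P x) <= 2 / d * rnorm (J x) ^+ n.
Proof.
move=> d0 small x; set N := rnorm (J x).
have scaled t : 0 <= t -> (t * N) ^+ n < d -> t ^+ n * rnorm (P x) < 1.
  move=> t0 tN; rewrite -homogeneous_rnorm//; apply: small.
  by rewrite linearZ rnorm_scale_of_real.
have := rnorm_ge0 (J x); rewrite -/N le_eqVlt => /orP[/eqP N0|N0].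
  rewrite -N0 expr0n gtn_eqF// mulr0 leNgt; apply/negP => r0.
  (* a factor t >= 1 with t * |P x| > 1, so that t ^ n * |P x| > 1 as well *)
  have t1 : 1 <= (rnorm (P x))^-1 + 1 by rewrite lerDr invr_ge0 ltW.
  have t0 := le_trans ler01 t1.
  have := scaled _ t0; rewrite -N0 mulr0 expr0n gtn_eqF// => /(_ d0).
  apply/negP; rewrite -leNgt.
  apply: (@le_trans _ _ (((rnorm (P x))^-1 + 1) * rnorm (P x))).
    by rewrite mulrDl mulVf ?gt_eqF// mul1r lerDl ltW.
  rewrite ler_wpM2r ?rnorm_ge0// -[leLHS]expr1.
  by apply: ler_weXn2l.
(* scale x so that its image has norm r, with r ^ n = d / 2 < d *)
pose r := (d / 2) `^ n%:R^-1.
have d20 : 0 <= d / 2 by rewrite divr_ge0// ltW.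
have rn : r ^+ n = d / 2.
  by rewrite -powR_mulrn ?powR_ge0// -powRrM mulVf ?powRr1// pnatr_eq0 -lt0n.
have rN0 : 0 <= r / N by rewrite divr_ge0 ?powR_ge0// ltW.
have := scaled _ rN0; rewrite divfK ?gt_eqF// rn.
have -> : d / 2 < d by rewrite ltr_pdivrMr// ltr_pMr// ltr1n.
move=> /(_ isT); rewrite expr_div_n rn => /ltW h.
have Nn : 0 < N ^+ n by rewrite exprn_gt0.
have -> : rnorm (P x) = (2 / d * N ^+ n) * (d / 2 / N ^+ n * rnorm (P x)).
  by field; rewrite !gt_eqF.
by rewrite ler_piMr// mulr_ge0 ?divr_ge0 ?ltW.
Qed.

Lemma factorization_dominated (mu : probability (borel (dual_ball E)) R)
    (G : closed_subspace (Lp_space mu p1))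
    (jpeG : forall x : E, Lp_inclusion mu p1 (evaluation x) \in csub_pred G)
    (v : {linear sym_tensor n G -> F}) :
  proj_s_continuous v ->
  (forall x : E, P x = v (diag_tensor n (csub_elt (jpeG x)))) ->
  p_dominated n p P.
Proof.
move=> vc Pv; have [d d0 dP] := vc 0 1 ltr01.
exists (2 / d); apply: (@domination_of_bound _ _ _ _ _ _ _ n_gt0 p1 mu).
  by rewrite divr_gt0.
apply: homogeneous_bound => // x xd.
have := dP (diag_tensor n (csub_elt (jpeG x))); rewrite subr0 linear0 subr0 Pv; apply.
apply: le_lt_trans (proj_s_norm_diag _) _. exact: xd.
Qed.

(** The constant in the Pietsch inequality is [||P||_{d,p}] itself, which bounds
    [||v||] from above. For the reverse bound [||v|| + e] is used instead of
    [||v||], because domination constants are positive by definition and [||v||]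
    may be zero. *)
Lemma dominated_factorization : p_dominated n p P ->
  exists (mu : probability (borel (dual_ball E)) R)
    (G : closed_subspace (Lp_space mu p1))
    (jpeG : forall x : E, Lp_inclusion mu p1 (evaluation x) \in csub_pred G)
    (v : {linear sym_tensor n G -> F}),
    [/\ regular_borel mu, proj_s_continuous v,
        forall x : E, P x = v (diag_tensor n (csub_elt (jpeG x))) &
        proj_s_opnorm v = dominated_norm n p P].
Proof.
move=> Pdom; have [c0 cdom] := dominated_norm_domination n_gt0 p1 Pdom.
set c := dominated_norm n p P in c0 cdom *.
have [mu rmu mudom] := pietsch_domination n_gt0 p1 homogeneous_rnorm c0 cdom.
pose J : {linear E -> Lp_space mu p1} := Lp_embedding mu p1.
have p0 : 0 < p by exact: lt_le_trans p1.
have n0 : 0 < n%:R :> R by rewrite ltr0n.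
have PJ x : rnorm (P x) <= c * rnorm (J x) ^+ n.
  have := mudom x; rewrite -rnorm_Lp_embedding -EFinM lee_fin -/J.
  rewrite (_ : rnorm (J x) `^ p = (rnorm (J x) ^+ n) `^ (p / n%:R)); last first.
    rewrite -powR_mulrn ?rnorm_ge0// -powRrM; congr (_ `^ _).
    by field; rewrite gt_eqF.
  rewrite -powRM ?exprn_ge0 ?rnorm_ge0//; apply: contraTT; rewrite -!ltNge => h.
  apply: gt0_ltr_powR => //; rewrite ?nnegrE ?rnorm_ge0 ?mulr_ge0 ?exprn_ge0 ?rnorm_ge0//.
  exact: divr_gt0.
pose G := range_closure J.
pose JG : {linear E -> G} := range_closure_map J.
have [_ [A [mA PA]]] := hP.
have PJG x : rnorm (A (fun=> x)) <= c * rnorm (JG x) ^+ n by rewrite -PA; exact: PJ.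
have [C C0 DC] := symmetrize_bounded mA c0 PJG.
have [D [mD Dapp]] := multilinear_extension (@range_closure_dense _ _ _ _ J)
  (multilinear_symmetrize mA) C0 DC.
pose B (g : 'I_n -> G) : F := (n`!%:R^-1 : K) *: D g.
have mB : multilinear B.
  by move=> i g a u w; rewrite /B mD scalerDr !scalerA mulrC.
have fact0 : n`!%:R != 0 :> K by rewrite pnatr_eq0 -lt0n fact_gt0.
(* dividing by n! turns the extension of the symmetrization into one of A *)
have Bapp (g : G) e : 0 < e -> exists2 d, 0 < d & forall x,
    rnorm (g - JG x) < d -> rnorm (B (fun=> g) - P x) < e.
  move=> e0; pose a := n`!%:R^-1 : K.
  have a1 : 0 < rnorm (a : K^o) + 1 by rewrite ltr_wpDl ?rnorm_ge0.
  have [d d0 dP] := Dapp (fun=> g) (e / (rnorm (a : K^o) + 1)) (divr_gt0 e0 a1).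
  exists d => // x gx; have := dP (fun=> x) (fun=> gx).
  rewrite symmetrize_diag -PA => h.
  have -> : B (fun=> g) - P x = a *: (D (fun=> g) - P x *+ n`!).
    by rewrite scalerBr -[in RHS]scaler_nat scalerA mulVf// scale1r.
  rewrite rnormZ (@le_lt_trans _ _ (rnorm (a : K^o) * (e / (rnorm (a : K^o) + 1))))//.
    by rewrite ler_wpM2l ?rnorm_ge0// ltW.
  by rewrite mulrCA gtr_pMr// ltr_pdivrMr// mul1r ltrDl.
have BP x : B (fun=> JG x) = P x.
  apply/eqP; rewrite -subr_eq0; apply/eqP/rnorm_eq0.
  apply/le_anti; rewrite rnorm_ge0 andbT; apply/ler_addgt0Pr => e e0.
  have [d d0 dP] := Bapp (JG x) e e0; rewrite add0r ltW//.
  by apply: dP; rewrite subrr rnorm0.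
have Bc g : rnorm (B (fun=> g)) <= c * rnorm g ^+ n.
  apply/ler_addgt0Pr => e e0; have e20 : 0 < e / 2 by rewrite divr_gt0.
  have : continuous (fun r : R => c * r ^+ n).
    by move=> r; apply: cvgMl_tmp; exact: exprn_continuous.
  move=> /(_ (rnorm g))/cvgrPdist_lt/(_ _ e20)/nbhs_ballP[d1 /= d10 d1P].
  have [d2 d20 d2P] := Bapp g _ e20.
  have [|x] := @range_closure_dense _ _ _ _ J g (Num.min d1 d2) _.
    by rewrite lt_min d10.
  rewrite -/JG lt_min => /andP[gx1 gx2].
  rewrite -[B _](subrK (P x)) (le_trans (ler_rnormD _ _))//.
  have : `|rnorm g - rnorm (JG x)| < d1.
    by apply: le_lt_trans gx1; exact: ler_dist_rnorm.
  move=> /d1P /=; rewrite ltr_norml => /andP[+ _].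
  have PJGx : rnorm (P x) <= c * rnorm (JG x) ^+ n by exact: PJ.
  have := d2P x gx2; move: PJGx; lra.
exists mu, G, (range_closureP J), (linearization mB); split=> //.
- exact: linearization_continuous c0 Bc.
- by move=> x; rewrite [RHS]linearization_diag -BP.
apply/le_anti/andP; split; first exact: opnorm_le c0 Bc.
apply/ler_addgt0Pr => e e0.
have s0 : 0 <= proj_s_opnorm (linearization mB) := opnorm_ge0 mB c0 Bc.
apply: ge_inf; first by exists 0 => M [/ltW].
apply: (@domination_of_bound _ _ _ _ _ _ _ n_gt0 p1 mu).
  by rewrite ltr_wpDl.
move=> x; rewrite -BP (le_trans (opnorm_ge mB c0 Bc _ n_gt0))//.
by rewrite ler_wpM2r ?exprn_ge0 ?rnorm_ge0// lerDl ltW.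
Qed.

End factorization.

Theorem proposition2 (R : realType) (k : scalar_kind)
    (E F : completeNormedModType (scalars R k))
    (n : nat) (n_gt0 : (0 < n)%N) (p : R) (p1 : 1 <= p)
    (P : E -> F) (hP : continuous_homogeneous_polynomial n P) :
  (p_dominated n p P <->
     exists (mu : probability (borel (dual_ball E)) R)
       (G : closed_subspace (Lp_space mu p1))
       (jpeG : forall x : E,
          Lp_inclusion mu p1 (evaluation x) \in csub_pred G)
       (v : {linear sym_tensor n G -> F}),
       [/\ regular_borel mu, proj_s_continuous v &
         forall x : E, P x = v (diag_tensor n (csub_elt (jpeG x)))]) /\
  (p_dominated n p P ->
     exists (mu : probability (borel (dual_ball E)) R)
       (G : closed_subspace (Lp_space mu p1))
       (jpeG : forall x : E,
          Lp_inclusion mu p1 (evaluation x) \in csub_pred G)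
       (v : {linear sym_tensor n G -> F}),
       [/\ regular_borel mu, proj_s_continuous v,
         forall x : E, P x = v (diag_tensor n (csub_elt (jpeG x))) &
         proj_s_opnorm v = dominated_norm n p P]).
Proof.
split; last exact: dominated_factorization.
split=> [/(dominated_factorization n_gt0 p1 hP)|].
  by move=> [mu [G [jG [v [rmu cv Pv _]]]]]; exists mu, G, jG, v.
by move=> [mu [G [jG [v [_ cv Pv]]]]]; exact: factorization_dominated cv Pv.
Qed.
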